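(* Consider front tracks of bicycling geodesics in $\mathbb{R}^3$ with associated vector $\mathbf{p}\neq 0$ and parameters $a,b\ge 0$. (a) Non-linear planar front tracks ($\tau=0$) are non-inflectional elasticae ($b=0$). The parameter values of the Euler soliton coincide with those of the straight line ($a=1$, $b=0$). The plane of the motion is parallel to $\mathbf{p}$. (b) The curvature of non-planar front tracks with constant torsion ($a=1$, $b>0$) is that of inflectional planar elasticae.
   Context: A bicycle path in $\mathbb{R}^3$ is a pair of curves $(\mathbf{x}(t),\mathbf{y}(t))$ (front and back tracks) such that $\mathbf{v}:=\mathbf{x}-\mathbf{y}$ satisfies $|\mathbf{v}|=1$ and $\mathbf{y}'\parallel\mathbf{v}$ for all $t$. A bicycling geodesic is a bicycle path whose length (the length of its front track) is critical among bicycle paths connecting two given placements of the segment. Front tracks are parametrized by arc length. Unit speed bicycling geodesics are exactly the bicycle paths for which there exist a constant vector $\mathbf{p}\in\mathbb{R}^3$ and $\mathbf{r}(t)\in\mathbb{R}^3$ with $$\mathbf{x}'=\mathbf{p}+\mathbf{r},\quad \mathbf{v}'=\mathbf{p}+\mathbf{r}-(\mathbf{v}\cdot\mathbf{p})\mathbf{v},\quad \mathbf{p}'=0,\quad \mathbf{r}'=(\mathbf{v}\cdot\mathbf{p})\mathbf{r}-[\mathbf{r}\cdot(\mathbf{r}+\mathbf{p})]\mathbf{v},\quad |\mathbf{v}|=1,\ \mathbf{r}\cdot\mathbf{v}=0,\ |\mathbf{x}'|=1.$$ The quantity $b:=\mathbf{p}\cdot(\mathbf{v}\times\mathbf{x}')$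 is constant with $|b|\le|\mathbf{p}|$, and $a\ge 0$ is defined by $a^2=|\mathbf{p}|^2-b^2$; by a reflection one may assume $b\ge0$. Non-linear means not a straight line. The curvature $\kappa$ and torsion $\tau$ of a non-linear front track are those of an analytic Frenet-Serret frame ($\mathbf{x}'=\mathbf{T}$, $\mathbf{T}'=\kappa\mathbf{N}$, $\mathbf{N}'=-\kappa\mathbf{T}+\tau\mathbf{B}$, $\mathbf{B}'=-\tau\mathbf{N}$), so $\kappa$ may change sign at inflection points (points where $\mathbf{x}''=0$). A planar elastica is a planar curve whose curvature as a function of arc length satisfies $\kappa''+\frac12\kappa^3+A\kappa=0$ for some constant $A$. A non-linear planar elastica is inflectional if its curvature vanishes somewhere, and non-inflectional if its curvature vanishes nowhere. The Euler soliton is the non-linear planar elastica which, in the present normalization, has curvature $\kappa(t)=2\,\mathrm{sech}(t)$, up to sign and shift of $t$.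
   Formalization: In (a), ''b=0'' and ''plane parallel to p'' are claimed only for a≠0: the unit circle with fixed back wheel and any nonzero p normal to its plane is a planar geodesic track with a=0, b=|p|>0, p orthogonal to the plane; for a=0 the motion is shown to be this circle. *)

(* Defs.v *)
From Stdlib Require Import Reals.
From Coquelicot Require Import Coquelicot.
Open Scope R_scope.

Definition vec : NormedModule R_AbsRing :=
  prod_NormedModule R_AbsRing
    (prod_NormedModule R_AbsRing R_NormedModule R_NormedModule) R_NormedModule.

Definition vec3 (a b c : R) : vec := (a, b, c).
Definition c1 (u : vec) : R := fst (fst u).
Definition c2 (u : vec) : R := snd (fst u).
Definition c3 (u : vec) : R := snd u.

Definition dot (u w : vec) : R := c1 u * c1 w + c2 u * c2 w + c3 u * c3 w.

Definition cross (u w : vec) : vec :=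
  vec3 (c2 u * c3 w - c3 u * c2 w)
       (c3 u * c1 w - c1 u * c3 w)
       (c1 u * c2 w - c2 u * c1 w).

(* The library norm of [vec] is not the Euclidean one; it is only used, through
   [is_derive], for its topology. *)
Definition enorm (u : vec) : R := sqrt (dot u u).

(* [x] is the front track, [y] the back track. *)
Definition bicycle_path (x y : R -> vec) : Prop :=
  forall t,
    ex_derive x t /\
    enorm (minus (x t) (y t)) = 1 /\
    exists l : R, is_derive y t (scal l (minus (x t) (y t))).

(* [p' = 0] is rendered by taking [p] to be a vector rather than a function. *)
Definition geodesic_equations (x v r : R -> vec) (p : vec) : Prop :=
  forall t,
    is_derive x t (plus p (r t)) /\
    is_derive v t
      (minus (plus p (r t)) (scal (dot (v t) p) (v t))) /\
    is_derive r t
      (minus (scal (dot (v t) p) (r t))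
             (scal (dot (r t) (plus (r t) p)) (v t))) /\
    enorm (v t) = 1 /\
    dot (r t) (v t) = 0 /\
    enorm (plus p (r t)) = 1.

(* A unit speed bicycling geodesic with associated vector [p]. *)
Definition bicycling_geodesic (x y : R -> vec) (p : vec) : Prop :=
  bicycle_path x y /\
  exists r : R -> vec,
    geodesic_equations x (fun t => minus (x t) (y t)) r p.

Definition parameters (x y : R -> vec) (p : vec) (a b : R) : Prop :=
  (forall t x', is_derive x t x' ->
     dot p (cross (minus (x t) (y t)) x') = b) /\
  a ^ 2 = enorm p ^ 2 - b ^ 2 /\ 0 <= a /\ 0 <= b.

Definition geodesic_with (x y : R -> vec) (p : vec) (a b : R) : Prop :=
  bicycling_geodesic x y p /\ p <> zero /\ parameters x y p a b.

Definition straight_line (x : R -> vec) : Prop :=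
  exists q d : vec, forall t, exists s : R, x t = plus q (scal s d).

Definition in_plane (n : vec) (c : R) (x : R -> vec) : Prop :=
  n <> zero /\ forall t, dot n (x t) = c.

Definition planar (x : R -> vec) : Prop := exists n c, in_plane n c x.

Definition analytic (f : R -> R) : Prop :=
  forall t0, exists c : nat -> R,
    Rbar_lt 0 (CV_radius c) /\
    locally t0 (fun t => f t = PSeries c (t - t0)).

Definition analytic_vec (u : R -> vec) : Prop :=
  analytic (fun t => c1 (u t)) /\
  analytic (fun t => c2 (u t)) /\
  analytic (fun t => c3 (u t)).

Definition frenet_frame (x T N B : R -> vec) (k tau : R -> R) : Prop :=
  (analytic_vec T /\ analytic_vec N /\ analytic_vec B /\
   analytic k /\ analytic tau) /\
  forall t,
    enorm (T t) = 1 /\ enorm (N t) = 1 /\ dot (T t) (N t) = 0 /\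
    B t = cross (T t) (N t) /\
    is_derive x t (T t) /\
    is_derive T t (scal (k t) (N t)) /\
    is_derive N t (plus (scal (- k t) (T t)) (scal (tau t) (B t))) /\
    is_derive B t (scal (- tau t) (N t)).

(* [k] is a signed curvature: it is determined by a non-linear curve only up to
   a global sign. *)
Definition curvature_torsion (x : R -> vec) (k tau : R -> R) : Prop :=
  exists T N B, frenet_frame x T N B k tau.

(* [k] is analytic here, so that [Derive_n] is a genuine derivative. *)
Definition planar_elastica (x : R -> vec) (k : R -> R) : Prop :=
  planar x /\
  (exists tau, curvature_torsion x k tau) /\
  exists A : R, forall t, Derive_n k 2 t + 1 / 2 * k t ^ 3 + A * k t = 0.

Definition inflectional_elastica (x : R -> vec) (k : R -> R) : Prop :=
  planar_elastica x k /\ ~ straight_line x /\ exists t, k t = 0.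

Definition non_inflectional_elastica (x : R -> vec) (k : R -> R) : Prop :=
  planar_elastica x k /\ ~ straight_line x /\ forall t, k t <> 0.

Definition euler_soliton (x : R -> vec) : Prop :=
  exists k,
    planar_elastica x k /\ ~ straight_line x /\
    exists e t0 : R, (e = 1 \/ e = -1) /\
      forall t, k t = e * (2 / cosh (t - t0)).

(* The back wheel stands still and the front wheel runs on the unit circle
   around it, in the plane orthogonal to [p].  Such a motion satisfies
   [geodesic_equations] for every [p] normal to the circle, zero or not. *)
Definition circle_normal_to (x y : R -> vec) (p : vec) : Prop :=
  exists q : vec, forall t,
    y t = q /\ enorm (minus (x t) q) = 1 /\ dot p (minus (x t) q) = 0.

(* Main.v *)
From Stdlib Require Import Reals Lra Lia Classical Wf_nat.
From Coquelicot Require Import Coquelicot.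
Require Import Defs.
Open Scope R_scope.

(** Write [T = x' = p + r], [s = T . p] and [w = v . p]; as [r] is orthogonal to [v], also
    [w = T . v].  The equations of motion close up on these two scalars:
    [s' = - w R] and [w' = s - w^2], where [R = |r|^2 = a^2 + b^2 + 1 - 2 s].  The Gram
    determinant of [(p, v, T)] equals [b^2], which is the first integral
    [w^2 R = a^2 - s^2] ([motion_profile]).  The Frenet data depend on [s] alone:
    [k^2 = a^2 + 1 - 2 s] and [2 k^2 tau = b (k^2 + a^2 - 1)] ([curvature_formula],
    [torsion_formula]).  The classification is read off from these identities.

    Since [R' = 2 w R] with [|w| <= 1], [R] vanishes everywhere or nowhere, and [R = 0] means
    [T = p], a straight line; so [R > 0] on a non-linear track ([motion_r_pos]).  Two facts
    follow.  At an inflection point [a = s = 1] and [w = 0], so that [w' = 1]: inflections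
    are isolated, and [k] can be cancelled from identities between continuous functions
    ([curvature_zeros_sparse]).  And [s] can be constant only if [w = 0], hence [s = w' = 0]
    and [a = 0] ([constant_curvature_circle]).

    A track is planar iff [tau = 0], that is, iff [b = 0] or [k^2] is the constant
    [1 - a^2], and the latter forces [a = 0], the circle.  If [b = 0] then [k^2 = R > 0],
    whence non-inflectional; differentiating [k^2] twice gives the elastica equation.
    If [tau] is a constant [c], then [k^2 (2 c - b) = b (a^2 - 1)], so either [a = 1] or [k^2] is
    constant and the track is again the circle.  If [a = 1] and [b > 0], then
    [tau = b / 2], and [k] satisfies the equation of an elastica with first integral
    [k'^2 = (k^2 + b^2) (4 - k^2) / 4].  Such a [k] must vanish somewhere: while it keeps
    a sign, the quotient [k' / (k^2 + b^2)] is strictly monotone, and a nonzero value of it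
    drives [k] linearly to zero ([curvature_vanishes]).

    A plane curve with a prescribed elastic curvature is obtained without integrating the
    tangent angle: the vector [(k^2 / 2 + A) T + k' N] is constant along an elastica, so
    the components of [T] are affine in [k^2 / 2 + A] and [k'], hence analytic
    ([frenet_frame_elastica]).

    Finally, [a = 1, b = 0] is realized both by a straight line and by the soliton, whose back
    track is a tractrix.  Conversely, [k = 0] forces [a = 1] and [b = 0], and
    for [b = 0] one has [k^2 >= (a - 1)^2], whereas [sech] comes arbitrarily close to [0]. *)

(** * Differentiation of vector-valued functions *)

Lemma is_derive_linear {U V : NormedModule R_AbsRing} (L : U -> V)
    (u : R -> U) (t : R) (u' : U) :
  is_linear L -> is_derive u t u' -> is_derive (fun s => L (u s)) t (L u').
Proof.
  intros HL Hu.
  unfold is_derive.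
  apply (filterdiff_ext_lin _ (fun y : R => L (scal y u'))).
  - exact (filterdiff_comp' u L t (fun y => scal y u') L Hu (filterdiff_linear L HL)).
  - intros y; apply (linear_scal L HL).
Qed.

Lemma is_derive_pair {U V : NormedModule R_AbsRing} (f : R -> U) (g : R -> V)
    (t : R) (f' : U) (g' : V) :
  is_derive f t f' -> is_derive g t g' ->
  is_derive (V := prod_NormedModule R_AbsRing U V) (fun s => (f s, g s)) t (f', g').
Proof.
  intros Hf Hg.
  unfold is_derive.
  apply (filterdiff_ext_lin (V := prod_NormedModule R_AbsRing U V) _
           (fun y : R => (scal y f', scal y g'))); [ | reflexivity].
  apply (filterdiff_comp'_2 (W := prod_NormedModule R_AbsRing U V) f g
    (fun a b => (a, b)) t (fun y => scal y f') (fun y => scal y g') (fun a b => (a, b)));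
    [exact Hf | exact Hg | ].
  apply (filterdiff_ext_lin _ (fun x => x)).
  - eapply filterdiff_ext; [ | apply filterdiff_id]; intros []; reflexivity.
  - intros []; reflexivity.
Qed.

Lemma vec_ext (u w : vec) : c1 u = c1 w -> c2 u = c2 w -> c3 u = c3 w -> u = w.
Proof.
  destruct u as [[u1 u2] u3], w as [[w1 w2] w3]; cbn; now intros -> -> ->.
Qed.

Ltac vec_simpl := unfold dot, cross, vec3, c1, c2, c3; cbn; unfold zero; cbn.
Ltac vec_ring := intros; vec_simpl; ring.

Lemma is_derive_vec_iff (u : R -> vec) (t : R) (u' : vec) :
  is_derive u t u' <->
  is_derive (fun s => c1 (u s)) t (c1 u') /\
  is_derive (fun s => c2 (u s)) t (c2 u') /\
  is_derive (fun s => c3 (u s)) t (c3 u').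
Proof.
  split.
  - intros H.
    assert (H12 := is_derive_linear _ _ _ _ is_linear_fst H).
    split; [ | split].
    + exact (is_derive_linear _ _ _ _ is_linear_fst H12).
    + exact (is_derive_linear _ _ _ _ is_linear_snd H12).
    + exact (is_derive_linear _ _ _ _ is_linear_snd H).
  - intros (H1 & H2 & H3).
    assert (H := is_derive_pair _ _ _ _ _ (is_derive_pair _ _ _ _ _ H1 H2) H3).
    assert (E : ((c1 u', c2 u'), c3 u') = u') by (destruct u' as [[]]; reflexivity).
    rewrite <- E.
    apply is_derive_ext with (2 := H); intros s; destruct (u s) as [[]]; reflexivity.
Qed.

Lemma is_derive_vec_unique (u : R -> vec) (t : R) (l l' : vec) :
  is_derive u t l -> is_derive u t l' -> l = l'.
Proof.
  intros H H'.
  apply is_derive_vec_iff in H as (H1 & H2 & H3).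
  apply is_derive_vec_iff in H' as (H1' & H2' & H3').
  apply vec_ext.
  - now rewrite <- (is_derive_unique _ _ _ H1), <- (is_derive_unique _ _ _ H1').
  - now rewrite <- (is_derive_unique _ _ _ H2), <- (is_derive_unique _ _ _ H2').
  - now rewrite <- (is_derive_unique _ _ _ H3), <- (is_derive_unique _ _ _ H3').
Qed.

Lemma is_derive_R_unique (f : R -> R) (t l l' : R) :
  is_derive f t l -> is_derive f t l' -> l = l'.
Proof.
  intros H H'; now rewrite <- (is_derive_unique _ _ _ H), <- (is_derive_unique _ _ _ H').
Qed.

Lemma is_derive_mult_R (f g : R -> R) (t f' g' : R) :
  is_derive f t f' -> is_derive g t g' ->
  is_derive (fun s => f s * g s) t (f' * g t + f t * g').
Proof. intros Hf Hg; apply (is_derive_mult f g t f' g' Hf Hg Rmult_comm). Qed.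

Lemma is_derive_eq {V : NormedModule R_AbsRing} (f : R -> V) (t : R) (l l' : V) :
  is_derive f t l -> l = l' -> is_derive f t l'.
Proof. now intros H <-. Qed.

Lemma is_derive_eq_R (f : R -> R) (t l l' : R) :
  is_derive f t l -> l = l' -> is_derive f t l'.
Proof. apply is_derive_eq. Qed.

Lemma is_derive_dot (u w : R -> vec) (t : R) (u' w' : vec) :
  is_derive u t u' -> is_derive w t w' ->
  is_derive (fun s => dot (u s) (w s)) t (dot u' (w t) + dot (u t) w').
Proof.
  intros H H'.
  apply is_derive_vec_iff in H as (H1 & H2 & H3).
  apply is_derive_vec_iff in H' as (H1' & H2' & H3').
  eapply is_derive_eq.
  - apply (is_derive_plus (V := R_NormedModule)); [ apply (is_derive_plus (V := R_NormedModule)) | ];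
      apply is_derive_mult_R; eassumption.
  - unfold dot, plus; cbn; ring.
Qed.

Lemma is_derive_dot_l (n : vec) (u : R -> vec) (t : R) (u' : vec) :
  is_derive u t u' -> is_derive (fun s => dot n (u s)) t (dot n u').
Proof.
  intros H.
  eapply is_derive_eq.
  - apply (is_derive_dot (fun _ => n)); [apply is_derive_const | exact H].
  - unfold dot; cbn; unfold zero; cbn; ring.
Qed.

Lemma derive_zero_const {V : NormedModule R_AbsRing} (f : R -> V) :
  (forall t, is_derive f t zero) -> forall t, f t = f 0.
Proof.
  intros H t.
  destruct (Rtotal_order t 0) as [h | [-> | h]]; trivial.
  - apply eq_is_derive; auto.
  - symmetry; apply eq_is_derive; auto.
Qed.

Lemma is_derive_const_0 {f : R -> R} {c t f' : R} :
  (forall s, f s = c) -> is_derive f t f' -> f' = 0.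
Proof.
  intros E H.
  apply (is_derive_R_unique f t); trivial.
  apply is_derive_ext with (fun _ => c); [now intros | apply (is_derive_const c t)].
Qed.

Lemma dot_enorm (u : vec) : enorm u ^ 2 = dot u u.
Proof.
  unfold enorm; apply pow2_sqrt; unfold dot; nra.
Qed.

Lemma enorm_1_iff (u : vec) : enorm u = 1 <-> dot u u = 1.
Proof.
  split; intros H.
  - rewrite <- dot_enorm, H; ring.
  - unfold enorm; rewrite H; apply sqrt_1.
Qed.

Lemma dot_self_0 (u : vec) : dot u u = 0 -> u = zero.
Proof.
  unfold dot; intros H; apply vec_ext; cbn; unfold zero; cbn; nra.
Qed.

Lemma nonincreasing_of_derive (f df : R -> R) (t1 t2 : R) :
  (forall t, is_derive f t (df t)) -> t1 <= t2 ->
  (forall t, t1 <= t <= t2 -> df t <= 0) -> f t2 <= f t1.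
Proof.
  intros Hd Hle Hs.
  destruct (MVT_gen f t1 t2 df) as (c & Hc & E).
  - intros t _; apply Hd.
  - intros t _; apply continuity_pt_filterlim, (ex_derive_continuous f); now exists (df t).
  - rewrite Rmin_left, Rmax_right in Hc by trivial.
    specialize (Hs c Hc); nra.
Qed.

Lemma minus_zero_eq (u w : vec) : minus u w = zero -> u = w.
Proof.
  intros E; apply vec_ext.
  - generalize (f_equal c1 E); vec_simpl; lra.
  - generalize (f_equal c2 E); vec_simpl; lra.
  - generalize (f_equal c3 E); vec_simpl; lra.
Qed.

Lemma is_derive_scal_vec (f : R -> R) (u : R -> vec) (t f' : R) (u' : vec) :
  is_derive f t f' -> is_derive u t u' ->
  is_derive (fun z => scal (f z) (u z)) t (plus (scal f' (u t)) (scal (f t) u')).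
Proof.
  intros Hf Hu; apply is_derive_vec_iff in Hu as (H1 & H2 & H3).
  apply is_derive_vec_iff; split; [ | split].
  - exact (is_derive_mult_R _ _ _ _ _ Hf H1).
  - exact (is_derive_mult_R _ _ _ _ _ Hf H2).
  - exact (is_derive_mult_R _ _ _ _ _ Hf H3).
Qed.

Ltac rewrite_Derive h :=
  match type of h with
  | is_derive ?f ?t ?l =>
      replace (Derive (fun x : R => f x) t) with l by (symmetry; apply is_derive_unique; exact h)
  end.

(** * Real analytic functions *)

Lemma locally_inside_radius (c : nat -> R) (t0 : R) :
  Rbar_lt 0 (CV_radius c) ->
  locally t0 (fun t => Rbar_lt (Rabs (t - t0)) (CV_radius c)).
Proof.
  intros H.
  assert (Hr : exists r : R, 0 < r /\ Rbar_le r (CV_radius c)).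
  { destruct (CV_radius c) as [r | | ]; cbn in *; [exists r | exists 1 | ]; lra. }
  destruct Hr as (r & Hr & Hle).
  exists (mkposreal r Hr); intros t Ht.
  apply Rbar_lt_le_trans with (2 := Hle), Ht.
Qed.

Lemma radius_pos_of_ex_pseries (c : nat -> R) (x : R) :
  0 < x -> ex_pseries c x -> Rbar_lt 0 (CV_radius c).
Proof.
  intros Hx Hex.
  apply Rbar_not_le_lt; intros Hle.
  apply (CV_disk_outside c x).
  - apply Rbar_le_lt_trans with (1 := Hle); cbn; rewrite Rabs_pos_eq; lra.
  - apply ex_series_lim_0, ex_series_ext with (2 := Hex).
    intros n; rewrite pow_n_pow; cbn; unfold scal; cbn; unfold mult; cbn; ring.
Qed.

Lemma radius_pos_of_geometric (c : nat -> R) (M q : R) :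
  0 < q -> (forall n, Rabs (c n) <= M * q ^ n) -> Rbar_lt 0 (CV_radius c).
Proof.
  intros Hq Hb.
  apply Rbar_lt_le_trans with (/ q); [now apply Rinv_0_lt_compat | ].
  apply (proj1 (CV_radius_bounded c)).
  exists M; intros n.
  rewrite Rabs_mult, (Rabs_pos_eq ((/ q) ^ n)), pow_inv
    by (apply pow_le; left; now apply Rinv_0_lt_compat).
  apply Rmult_le_reg_r with (q ^ n); [now apply pow_lt | ].
  rewrite Rmult_assoc, Rinv_l, Rmult_1_r by (apply pow_nonzero; lra).
  apply Hb.
Qed.

Lemma geometric_of_radius_pos (c : nat -> R) :
  Rbar_lt 0 (CV_radius c) ->
  exists M q : R, 0 < M /\ 0 < q /\ forall n, Rabs (c n) <= M * q ^ n.
Proof.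
  intros H.
  destruct (classic (exists r M : R, 0 < r /\ forall n, Rabs (c n * r ^ n) <= M)) as [(r & M & Hr & Hb) | Hn].
  - exists (Rabs M + 1), (/ r).
    assert (HM := Rabs_pos M).
    split; [lra | split; [now apply Rinv_0_lt_compat | ] ].
    intros n; specialize (Hb n).
    rewrite Rabs_mult, (Rabs_pos_eq (r ^ n)) in Hb by (apply pow_le; lra).
    apply Rmult_le_reg_r with (r ^ n); [now apply pow_lt | ].
    rewrite Rmult_assoc, pow_inv, Rinv_l by (apply pow_nonzero; lra).
    assert (h := Rle_abs M); lra.
  - exfalso; revert H; apply Rbar_le_not_lt.
    apply (proj2 (CV_radius_bounded c)).
    intros r (M & HM); cbn.
    apply Rnot_lt_le; intros Hr; apply Hn; now exists r, M.
Qed.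

Lemma analytic_ext (f g : R -> R) :
  (forall t, f t = g t) -> analytic f -> analytic g.
Proof.
  intros E Hf t0; destruct (Hf t0) as (c & Hc & Hl); exists c; split; trivial.
  apply filter_imp with (2 := Hl); intros t <-; now symmetry.
Qed.

Lemma analytic_const (a : R) : analytic (fun _ => a).
Proof.
  intros t0; exists (fun n => match n with O => a | S _ => 0 end).
  assert (E : CV_radius (fun n => match n with O => a | S _ => 0 end) = p_infty).
  { rewrite <- CV_radius_decr_1, <- CV_radius_const_0; apply CV_radius_ext; intros n; reflexivity. }
  rewrite E; split; [exact I | ].
  apply filter_forall; intros t.
  rewrite PSeries_decr_1 by (apply CV_radius_inside; rewrite E; exact I).
  rewrite (PSeries_ext _ (fun _ => 0)), PSeries_const_0 by (intros n; reflexivity).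
  ring.
Qed.

Lemma analytic_plus (f g : R -> R) :
  analytic f -> analytic g -> analytic (fun t => f t + g t).
Proof.
  intros Hf Hg t0.
  destruct (Hf t0) as (c & Hc & Hcl), (Hg t0) as (d & Hd & Hdl).
  exists (PS_plus c d); split.
  - apply Rbar_lt_le_trans with (2 := CV_radius_plus c d).
    now apply Rbar_min_case.
  - assert (Hcr := locally_inside_radius c t0 Hc).
    assert (Hdr := locally_inside_radius d t0 Hd).
    generalize (filter_and _ _ (filter_and _ _ Hcl Hdl) (filter_and _ _ Hcr Hdr)).
    apply filter_imp; intros t [[-> ->] [h h']].
    rewrite PSeries_plus; trivial; now apply CV_radius_inside.
Qed.

Lemma radius_mult_pos (c d : nat -> R) :
  Rbar_lt 0 (CV_radius c) -> Rbar_lt 0 (CV_radius d) -> Rbar_lt 0 (CV_radius (PS_mult c d)).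
Proof.
  intros Hc Hd.
  destruct (filter_and _ _ (locally_inside_radius c 0 Hc) (locally_inside_radius d 0 Hd))
    as [eps He].
  assert (Hp := cond_pos eps).
  assert (Hb : ball 0 eps (eps / 2)).
  { unfold ball; cbn; unfold AbsRing_ball, abs, minus, plus, opp; cbn.
    rewrite Rabs_pos_eq; lra. }
  destruct (He _ Hb) as [h h']; rewrite Rminus_0_r in h, h'.
  apply radius_pos_of_ex_pseries with (pos eps / 2); [lra | ].
  now apply ex_pseries_mult.
Qed.

Lemma analytic_mult (f g : R -> R) :
  analytic f -> analytic g -> analytic (fun t => f t * g t).
Proof.
  intros Hf Hg t0.
  destruct (Hf t0) as (c & Hc & Hcl), (Hg t0) as (d & Hd & Hdl).
  exists (PS_mult c d); split.
  - now apply radius_mult_pos.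
  - assert (Hcr := locally_inside_radius c t0 Hc).
    assert (Hdr := locally_inside_radius d t0 Hd).
    generalize (filter_and _ _ (filter_and _ _ Hcl Hdl) (filter_and _ _ Hcr Hdr)).
    apply filter_imp; intros t [[-> ->] [h h']].
    now rewrite PSeries_mult.
Qed.

Lemma analytic_scal (a : R) (f : R -> R) : analytic f -> analytic (fun t => a * f t).
Proof. apply (analytic_mult (fun _ => a)), analytic_const. Qed.

Lemma analytic_locally_derive (f : R -> R) (t0 : R) (c : nat -> R) :
  Rbar_lt 0 (CV_radius c) -> locally t0 (fun t => f t = PSeries c (t - t0)) ->
  locally t0 (fun t => is_derive f t (PSeries (PS_derive c) (t - t0))).
Proof.
  intros Hc Hl.
  apply locally_locally in Hl.
  generalize (filter_and _ _ Hl (locally_inside_radius c t0 Hc)).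
  apply filter_imp; intros t [Ht Hr].
  apply is_derive_ext_loc with (fun s => PSeries c (s - t0)).
  - apply filter_imp with (2 := Ht); now intros s ->.
  - eapply is_derive_eq.
    + apply (is_derive_comp (PSeries c) (fun s => s - t0)).
      * now apply is_derive_PSeries.
      * auto_derive; [exact I | reflexivity].
    + apply (scal_one (PSeries (PS_derive c) (t - t0))).
Qed.

Lemma analytic_ex_derive (f : R -> R) : analytic f -> forall t, ex_derive f t.
Proof.
  intros Hf t; destruct (Hf t) as (c & Hc & Hl).
  eexists; exact (locally_singleton _ _ (analytic_locally_derive f t c Hc Hl)).
Qed.

Lemma analytic_Derive (f : R -> R) : analytic f -> analytic (Derive f).
Proof.
  intros Hf t0; destruct (Hf t0) as (c & Hc & Hl).
  exists (PS_derive c); split; [now rewrite CV_radius_derive | ].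
  generalize (analytic_locally_derive f t0 c Hc Hl).
  apply filter_imp; intros t; apply is_derive_unique.
Qed.

(** The recursion for the coefficients of [1 / c] uses all earlier ones, so it is run on the table of
    entries up to [n]; larger indices repeat the last entry computed. *)
Fixpoint reciprocal_upto (c : nat -> R) (n : nat) : nat -> R :=
  match n with
  | O => fun _ => / c 0%nat
  | S m => fun i =>
      if Nat.leb i m then reciprocal_upto c m i
      else - / c 0%nat *
             sum_f_R0 (fun j => c (S j) * reciprocal_upto c m (m - j)%nat) m
  end.

Definition reciprocal (c : nat -> R) (n : nat) : R := reciprocal_upto c n n.

Lemma reciprocal_upto_stable (c : nat -> R) (n i : nat) :
  (i <= n)%nat -> reciprocal_upto c n i = reciprocal c i.
Proof.
  induction n as [ | n IH]; intros Hi.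
  - now replace i with 0%nat by lia.
  - destruct (Nat.eq_dec i (S n)) as [-> | Hne]; [reflexivity | ].
    cbn; rewrite (proj2 (Nat.leb_le i n)) by lia; apply IH; lia.
Qed.

Lemma reciprocal_S (c : nat -> R) (n : nat) :
  reciprocal c (S n) =
  - / c 0%nat * sum_f_R0 (fun j => c (S j) * reciprocal c (n - j)%nat) n.
Proof.
  unfold reciprocal at 1; cbn [reciprocal_upto].
  rewrite (proj2 (Nat.leb_gt (S n) n)) by lia.
  f_equal; apply sum_eq; intros j Hj; rewrite reciprocal_upto_stable by lia; reflexivity.
Qed.

Lemma PS_mult_reciprocal (c : nat -> R) (n : nat) :
  c 0%nat <> 0 -> PS_mult c (reciprocal c) n = match n with O => 1 | S _ => 0 end.
Proof.
  intros H0; unfold PS_mult; destruct n as [ | n].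
  - cbn; unfold reciprocal; cbn; now field.
  - rewrite decomp_sum by lia; cbn [Nat.pred].
    rewrite Nat.sub_0_r, reciprocal_S.
    cbn [Nat.sub].
    now field.
Qed.

(** The growth rate [Q = q (1 + M)] is chosen so that the recursion for the reciprocal of a
    series with coefficients bounded by [M q ^ n] reproduces a bound by a multiple of [Q ^ n]. *)
Lemma geometric_convolution (M q Q : R) (n : nat) :
  Q = q * (1 + M) ->
  M * sum_f_R0 (fun j => q ^ S j * Q ^ (n - j)) n = Q ^ S n - q ^ S n.
Proof.
  intros HQ; induction n as [ | n IH].
  - cbn; rewrite HQ; ring.
  - rewrite tech5, Nat.sub_diag.
    rewrite (sum_eq _ (fun j => q ^ S j * Q ^ (n - j) * Q))
      by (intros j Hj; rewrite Nat.sub_succ_l by lia; cbn; ring).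
    rewrite <- scal_sum, Rmult_plus_distr_l.
    replace (M * (Q * sum_f_R0 (fun j => q ^ S j * Q ^ (n - j)) n))
      with (Q * (M * sum_f_R0 (fun j => q ^ S j * Q ^ (n - j)) n)) by ring.
    rewrite IH; cbn [pow]; rewrite HQ; ring.
Qed.

Lemma reciprocal_radius_pos (c : nat -> R) :
  c 0%nat <> 0 -> Rbar_lt 0 (CV_radius c) -> Rbar_lt 0 (CV_radius (reciprocal c)).
Proof.
  intros H0 Hc.
  destruct (geometric_of_radius_pos c Hc) as (M0 & q & HM0 & Hq & Hb).
  assert (Hi : 0 < / Rabs (c 0%nat)) by now apply Rinv_0_lt_compat, Rabs_pos_lt.
  set (i0 := / Rabs (c 0%nat)) in *.
  set (M := i0 * M0).
  assert (HM : 0 < M) by now apply Rmult_lt_0_compat.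
  set (Q := q * (1 + M)).
  assert (HQ : 0 < Q) by (apply Rmult_lt_0_compat; lra).
  apply radius_pos_of_geometric with i0 Q; trivial.
  intros n; induction n as [n IH] using lt_wf_ind.
  destruct n as [ | n].
  - unfold reciprocal; cbn; rewrite Rabs_inv; fold i0; lra.
  - rewrite reciprocal_S, Rabs_mult, Rabs_Ropp, Rabs_inv; fold i0.
    apply Rmult_le_compat_l; [lra | ].
    apply Rle_trans with (1 := Rsum_abs _ _).
    apply Rle_trans with (sum_f_R0 (fun j => q ^ S j * Q ^ (n - j) * M) n).
    + apply sum_Rle; intros j Hj.
      rewrite Rabs_mult.
      apply Rle_trans with (M0 * q ^ S j * (i0 * Q ^ (n - j))).
      * apply Rmult_le_compat; try apply Rabs_pos; [apply Hb | apply IH; lia].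
      * unfold M; right; ring.
    + rewrite <- scal_sum, geometric_convolution by reflexivity.
      assert (h := pow_lt q (S n) Hq); lra.
Qed.

(** Near [t0] the reciprocal is the sum of the series inverse to that of [f] for the Cauchy
    product, which has positive radius by [reciprocal_radius_pos]. *)
Lemma analytic_inv (f : R -> R) :
  analytic f -> (forall t, f t <> 0) -> analytic (fun t => / f t).
Proof.
  intros Hf Hn t0; destruct (Hf t0) as (c & Hc & Hl).
  assert (H0 : c 0%nat <> 0).
  { assert (E := locally_singleton _ _ Hl); cbn beta in E.
    rewrite Rminus_diag, PSeries_0 in E; rewrite <- E; apply Hn. }
  assert (Hd := reciprocal_radius_pos c H0 Hc).
  exists (reciprocal c); split; trivial.
  generalize (filter_and _ _ Hl
    (filter_and _ _ (locally_inside_radius c t0 Hc) (locally_inside_radius _ t0 Hd))).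
  apply filter_imp; intros t [Ht [hc hd]].
  assert (E : f t * PSeries (reciprocal c) (t - t0) = 1).
  { rewrite Ht, <- PSeries_mult by trivial.
    rewrite PSeries_decr_1 by now apply ex_pseries_mult.
    rewrite (PSeries_ext _ (fun _ => 0)), PSeries_const_0
      by (intros n; apply (PS_mult_reciprocal c (S n) H0)).
    rewrite (PS_mult_reciprocal c 0 H0); ring. }
  apply Rmult_eq_reg_l with (f t); [ | apply Hn].
  rewrite E; field; apply Hn.
Qed.

Lemma analytic_exp : analytic exp.
Proof.
  assert (E : CV_radius (fun n => / INR (Factorial.fact n)) = p_infty).
  { apply CV_radius_infinite_DAlembert.
    - intros n; apply Rinv_neq_0_compat, INR_fact_neq_0.
    - apply is_lim_seq_ext with (fun n => / INR (S n)).
      + intros n; change (Factorial.fact (S n)) with (S n * Factorial.fact n)%nat; rewrite mult_INR.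
        assert (h := INR_fact_neq_0 n); assert (h' := not_0_INR (S n) (Nat.neq_succ_0 n)).
        replace (_ / _) with (/ INR (S n)) by now field.
        rewrite Rabs_pos_eq; trivial.
        left; apply Rinv_0_lt_compat, lt_0_INR; lia.
      + apply (is_lim_seq_incr_1 (fun n => / INR n)).
        apply (is_lim_seq_inv INR p_infty); [apply is_lim_seq_INR | discriminate]. }
  intros t0; exists (PS_scal (exp t0) (fun n => / INR (Factorial.fact n))).
  rewrite CV_radius_scal by (apply Rgt_not_eq, exp_pos).
  rewrite E; split; [exact I | ].
  apply filter_forall; intros t.
  rewrite PSeries_scal, <- exp_Reals, <- exp_plus.
  now rewrite Rplus_minus.
Qed.

(** * The equations of motion *)

(** The derivative of [T] with [r] eliminated: [r = T - p], and [r . (r + p) = 1 - T . p]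
    because [|T| = 1]. *)
Definition accel (p T v : vec) : vec :=
  minus (scal (dot v p) (minus T p)) (scal (1 - dot T p) v).

(** The geodesic equations in terms of [T = p + r] only; [r . v = 0] becomes [T . v = v . p]. *)
Record motion (x T v : R -> vec) (p : vec) (a b : R) : Prop := {
  motion_dx : forall t, is_derive x t (T t);
  motion_dv : forall t, is_derive v t (minus (T t) (scal (dot (v t) p) (v t)));
  motion_dT : forall t, is_derive T t (accel p (T t) (v t));
  motion_T1 : forall t, dot (T t) (T t) = 1;
  motion_v1 : forall t, dot (v t) (v t) = 1;
  motion_Tv : forall t, dot (T t) (v t) = dot (v t) p;
  motion_b : forall t, dot p (cross (v t) (T t)) = b;
  motion_p : dot p p = a ^ 2 + b ^ 2;
  motion_a0 : 0 <= a;
  motion_b0 : 0 <= b }.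

Arguments motion_dx {x T v p a b}.
Arguments motion_dv {x T v p a b}.
Arguments motion_dT {x T v p a b}.
Arguments motion_T1 {x T v p a b}.
Arguments motion_v1 {x T v p a b}.
Arguments motion_Tv {x T v p a b}.
Arguments motion_b {x T v p a b}.
Arguments motion_p {x T v p a b}.
Arguments motion_a0 {x T v p a b}.
Arguments motion_b0 {x T v p a b}.

Lemma geodesic_motion (x y : R -> vec) (p : vec) (a b : R) :
  geodesic_with x y p a b ->
  exists T, motion x T (fun t => minus (x t) (y t)) p a b.
Proof.
  intros [[Hpath (r & Hgeo)] [Hp0 (Hb & Ha & Ha0 & Hb0)]].
  exists (fun t => plus p (r t)).
  assert (HT : forall t, dot (plus p (r t)) (plus p (r t)) = 1)
    by (intros t; apply enorm_1_iff, Hgeo).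
  split; trivial; try (intros t; destruct (Hgeo t) as (h1 & h2 & h3 & h4 & h5 & h6)).
  - exact h1.
  - exact h2.
  - apply (is_derive_eq _ _ (plus zero (minus (scal (dot (minus (x t) (y t)) p) (r t))
             (scal (dot (r t) (plus (r t) p)) (minus (x t) (y t)))))).
    + apply (is_derive_plus (fun _ => p)); [apply (is_derive_const p) | exact h3].
    + rewrite plus_zero_l; unfold accel.
      assert (E1 : minus (plus p (r t)) p = r t) by (apply vec_ext; vec_ring).
      rewrite E1; do 3 f_equal.
      specialize (HT t); revert HT; vec_simpl; lra.
  - now apply enorm_1_iff.
  - rewrite <- (Rplus_0_r (dot _ p)), <- h5; vec_ring.
  - now apply Hb.
  - rewrite dot_enorm in Ha; lra.
Qed.

(** * The two scalar unknowns *)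

(** The closed system satisfied by [s = T . p] and [w = v . p]; the recurring expression
    [a ^ 2 + b ^ 2 + 1 - 2 * s t] is [|r|^2]. *)
Record profile (a b : R) (s w : R -> R) : Prop := {
  profile_ds : forall t, is_derive s t (- (w t * (a ^ 2 + b ^ 2 + 1 - 2 * s t)));
  profile_dw : forall t, is_derive w t (s t - w t ^ 2);
  profile_energy : forall t, w t ^ 2 * (a ^ 2 + b ^ 2 + 1 - 2 * s t) = a ^ 2 - s t ^ 2;
  profile_w : forall t, -1 <= w t <= 1;
  profile_pos : forall t, 0 <= a ^ 2 + b ^ 2 + 1 - 2 * s t }.

Arguments profile_ds {a b s w}.
Arguments profile_dw {a b s w}.
Arguments profile_energy {a b s w}.
Arguments profile_w {a b s w}.
Arguments profile_pos {a b s w}.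

Lemma dot_self_ge_0 (u : vec) : 0 <= dot u u.
Proof. unfold dot; nra. Qed.

Lemma norm_r (T p : vec) : dot T T = 1 ->
  dot (minus T p) (minus T p) = dot p p + 1 - 2 * dot T p.
Proof. intros <-; vec_ring. Qed.

Lemma dot_unit_bounds (u w : vec) : dot u u = 1 -> dot w w = 1 -> -1 <= dot u w <= 1.
Proof.
  intros Hu Hw.
  assert (H1 := dot_self_ge_0 (plus u w)); assert (H2 := dot_self_ge_0 (minus u w)).
  revert Hu Hw H1 H2; vec_simpl; lra.
Qed.

(** The square of a triple product is the Gram determinant, here expanded for a triple whose
    inner products are known along a motion. *)
Lemma gram_det (p v T : vec) :
  dot p (cross v T) ^ 2 =
  dot p p * (dot v v * dot T T - dot T v ^ 2)
  - dot v p * (dot v p * dot T T - dot T v * dot T p)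
  + dot T p * (dot v p * dot T v - dot v v * dot T p).
Proof. vec_ring. Qed.

(** The first integral is [gram_det] with [|v| = |T| = 1] and [T . v = v . p] inserted. *)
Lemma motion_profile {x T v : R -> vec} {p : vec} {a b : R} :
  motion x T v p a b -> profile a b (fun t => dot (T t) p) (fun t => dot (v t) p).
Proof.
  intros M.
  split; intros t; destruct M as [Mx Mv MT MT1 Mv1 MTv Mb Mp _ _ _];
    specialize (MT1 t); specialize (Mv1 t); specialize (MTv t); specialize (Mb t).
  - eapply is_derive_eq; [apply (is_derive_dot T (fun _ => p)) | ].
    + apply MT.
    + apply (is_derive_const p).
    + rewrite <- Mp; unfold accel.
      vec_ring.
  - eapply is_derive_eq; [apply (is_derive_dot v (fun _ => p)) | ].
    + apply Mv.
    + apply (is_derive_const p).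
    + vec_ring.
  - cbv beta. assert (G := gram_det p (v t) (T t)).
    rewrite Mb, MT1, Mv1, MTv, Mp in G; nra.
  - rewrite <- MTv; now apply dot_unit_bounds.
  - rewrite <- Mp, <- norm_r by trivial; apply dot_self_ge_0.
Qed.

Lemma accel_norm {x T v : R -> vec} {p : vec} {a b : R} :
  motion x T v p a b -> forall t,
  dot (accel p (T t) (v t)) (accel p (T t) (v t)) = a ^ 2 + 1 - 2 * dot (T t) p.
Proof.
  intros M t; assert (E := profile_energy (motion_profile M) t).
  cbn beta in E.
  transitivity (dot (v t) p ^ 2 * dot (minus (T t) p) (minus (T t) p)
    - 2 * dot (v t) p * (1 - dot (T t) p) * (dot (T t) (v t) - dot (v t) p)
    + (1 - dot (T t) p) ^ 2 * dot (v t) (v t)); [unfold accel; vec_ring | ].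
  rewrite norm_r, (motion_p M), (motion_Tv M),
    (motion_v1 M) by apply (motion_T1 M).
  rewrite E; ring.
Qed.

(** With [R = |r|^2] one has [R' = 2 w R] and [|w| <= 1], so [R exp (- 2 t)] is nonincreasing
    and [R exp (2 t)] is nondecreasing: a zero of [R] spreads forwards by the first and
    backwards by the second. *)
Lemma r_vanishes_everywhere (a b : R) (s w : R -> R) (t0 : R) :
  profile a b s w -> a ^ 2 + b ^ 2 + 1 - 2 * s t0 = 0 ->
  forall t, a ^ 2 + b ^ 2 + 1 - 2 * s t = 0.
Proof.
  intros P H0 t.
  assert (Hd : forall e u, is_derive (fun z => (a ^ 2 + b ^ 2 + 1 - 2 * s z) * exp (e * z)) u
            ((2 * w u + e) * (a ^ 2 + b ^ 2 + 1 - 2 * s u) * exp (e * u))).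
  { intros e u.
    assert (h := profile_ds P u).
    auto_derive; [now exists (- (w u * (a ^ 2 + b ^ 2 + 1 - 2 * s u))) | ].
    replace (Derive (fun x => s x) u) with (- (w u * (a ^ 2 + b ^ 2 + 1 - 2 * s u)))
      by (symmetry; now apply is_derive_unique).
    ring. }
  assert (Hp := profile_pos P); assert (Hw := profile_w P).
  apply Rle_antisym; [ | apply Hp].
  destruct (Rle_lt_dec t0 t) as [h | h].
  - assert (L := nonincreasing_of_derive _ _ t0 t (Hd (-2)) h); cbn beta in L.
    apply Rmult_le_reg_r with (exp (-2 * t)); [apply exp_pos | ].
    rewrite H0 in L; rewrite Rmult_0_l in *; apply L.
    intros u _; assert (h1 := Hp u); assert (h2 := Hw u); assert (h3 := exp_pos (-2 * u)).
    assert (0 <= (2 - 2 * w u) * (a ^ 2 + b ^ 2 + 1 - 2 * s u)) by (apply Rmult_le_pos; lra).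
    nra.
  - assert (Hd' : forall u, is_derive (fun z => - ((a ^ 2 + b ^ 2 + 1 - 2 * s z) * exp (2 * z))) u
            (- ((2 * w u + 2) * (a ^ 2 + b ^ 2 + 1 - 2 * s u) * exp (2 * u))))
      by (intros u; apply (is_derive_opp (V := R_NormedModule)), Hd).
    assert (L := nonincreasing_of_derive _ _ t t0 Hd' (Rlt_le _ _ h)); cbn beta in L.
    apply Rmult_le_reg_r with (exp (2 * t)); [apply exp_pos | ].
    rewrite H0 in L; rewrite Rmult_0_l in *; apply Ropp_le_cancel, L.
    intros u _; assert (h1 := Hp u); assert (h2 := Hw u); assert (h3 := exp_pos (2 * u)).
    assert (0 <= (2 + 2 * w u) * (a ^ 2 + b ^ 2 + 1 - 2 * s u)) by (apply Rmult_le_pos; lra).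
    nra.
Qed.

(** If [r] vanishes at one time it vanishes identically, and then [T = p] is constant. *)
Lemma motion_r_pos {x T v : R -> vec} {p : vec} {a b : R} :
  motion x T v p a b -> ~ straight_line x ->
  forall t, 0 < a ^ 2 + b ^ 2 + 1 - 2 * dot (T t) p.
Proof.
  intros M Hx t.
  assert (P := motion_profile M).
  destruct (profile_pos P t) as [h | h]; trivial.
  exfalso; apply Hx.
  assert (H := r_vanishes_everywhere _ _ _ _ t P (eq_sym h)).
  assert (HT : forall u, T u = p).
  { intros u.
    assert (E : minus (T u) p = zero).
    { apply dot_self_0.
      rewrite norm_r, (motion_p M) by apply (motion_T1 M).
      apply H. }
    now apply minus_zero_eq. }
  exists (x 0), p; intros u; exists u.
  assert (D : forall z, is_derive (fun z => minus (x z) (scal z p)) z zero).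
  { intros z.
    apply (is_derive_eq _ _ (minus p (scal one p))).
    - apply (is_derive_minus x (fun z => scal z p)).
      + rewrite <- (HT z); apply (motion_dx M).
      + apply (is_derive_scal_l (fun z => z) z one p), (is_derive_id z).
    - rewrite (scal_one p); apply vec_ext; vec_ring. }
  assert (E := derive_zero_const _ D u); cbn beta in E.
  apply vec_ext; [generalize (f_equal c1 E) | generalize (f_equal c2 E) | generalize (f_equal c3 E)];
    vec_simpl; lra.
Qed.

(** * Curvature and torsion in terms of the profile *)

(** Where [a ^ 2 + 1 - 2 s] vanishes the first integral reads
    [(a ^ 2 - 1) ^ 2 = - 4 (w b) ^ 2], so both sides are zero. *)
Lemma inflection_point (a b : R) (s w : R -> R) (t : R) :
  profile a b s w -> 0 <= a -> 0 < a ^ 2 + b ^ 2 + 1 - 2 * s t ->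
  a ^ 2 + 1 - 2 * s t = 0 -> a = 1 /\ s t = 1 /\ w t = 0.
Proof.
  intros P Ha Hr HK.
  assert (E := profile_energy P t).
  assert (Ea : a ^ 2 = 1).
  { replace (s t) with ((a ^ 2 + 1) / 2) in E by lra.
    assert (H1 : (a ^ 2 - 1) ^ 2 = - 4 * (w t * b) ^ 2) by lra.
    assert (H2 := pow2_ge_0 (w t * b)); assert (H3 := pow2_ge_0 (a ^ 2 - 1)).
    assert (H4 : (a ^ 2 - 1) ^ 2 = 0) by lra.
    apply Rminus_diag_uniq, Rsqr_0_uniq; rewrite Rsqr_pow2; exact H4. }
  assert (Es : s t = 1) by lra.
  split; [ | split; trivial].
  - assert (H : (a - 1) * (a + 1) = 0) by lra.
    apply Rmult_integral in H; lra.
  - rewrite Es, Ea in E; rewrite Es, Ea in Hr.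
    assert (H : w t ^ 2 * (1 + b ^ 2 + 1 - 2 * 1) = 0) by lra.
    apply Rmult_integral in H as [H | H]; [ | lra].
    apply Rsqr_0_uniq; now rewrite Rsqr_pow2.
Qed.

(** Inflections are isolated: there [w = 0] and [w' = s - w ^ 2 = 1].  This is what allows
    dividing by [k] in the identities below. *)
Lemma curvature_zeros_sparse (a b : R) (s w k g : R -> R) :
  profile a b s w -> 0 <= a -> (forall t, 0 < a ^ 2 + b ^ 2 + 1 - 2 * s t) ->
  (forall t, k t ^ 2 = a ^ 2 + 1 - 2 * s t) ->
  (forall t, continuous g t) -> (forall t, k t <> 0 -> g t = 0) -> forall t, g t = 0.
Proof.
  intros P Ha Hr Hk Hg Hkg t.
  destruct (Req_dec (k t) 0) as [Hk0 | Hk0]; [ | now apply Hkg].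
  destruct (Req_dec (g t) 0) as [ | Hg0]; trivial; exfalso.
  assert (Hz : forall u, k u = 0 -> s u = 1 /\ w u = 0).
  { intros u Hu; apply (inflection_point a b s w u); trivial.
    rewrite <- Hk, Hu; ring. }
  assert (Hloc : locally t (fun u => w u = 0)).
  { assert (Hn : locally t (fun u => g u <> 0))
      by exact (Hg t _ (open_neq 0 (g t) Hg0)).
    apply filter_imp with (2 := Hn); intros u Hu.
    apply Hz, NNPP; intros Hk1; apply Hu, Hkg, Hk1. }
  assert (D : is_derive w t 0).
  { apply is_derive_ext_loc with (fun _ => 0).
    - apply filter_imp with (2 := Hloc); now intros u ->.
    - apply (is_derive_const 0). }
  assert (E := is_derive_R_unique _ _ _ _ D (profile_dw P t)).
  destruct (Hz t Hk0) as [-> ->] in E; lra.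
Qed.

(** [s' = 0] gives [w = 0], hence [0 = w' = s], and the first integral becomes [a ^ 2 = 0]. *)
Lemma constant_curvature_circle (a b c : R) (s w : R -> R) :
  profile a b s w -> (forall t, 0 < a ^ 2 + b ^ 2 + 1 - 2 * s t) ->
  (forall t, s t = c) -> a = 0.
Proof.
  intros P Hr Hs.
  assert (Hw : forall t, w t = 0).
  { intros t.
    assert (E := is_derive_const_0 Hs (profile_ds P t)).
    specialize (Hr t); nra. }
  assert (E := is_derive_const_0 Hw (profile_dw P 0)).
  assert (E' := profile_energy P 0).
  rewrite Hw in E, E'; nra.
Qed.

Lemma circle_profile (b : R) (s w : R -> R) :
  profile 0 b s w -> (forall t, 0 < 0 ^ 2 + b ^ 2 + 1 - 2 * s t) ->
  forall t, s t = 0 /\ w t = 0.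
Proof.
  intros P Hr t.
  assert (E := profile_energy P t); specialize (Hr t).
  assert (Hs : s t = 0) by nra.
  split; trivial; rewrite Hs in *; nra.
Qed.

(** If [b <> 0] and [tau = 0], the torsion formula makes [k ^ 2] constant, which happens only
    on the circle [a = 0]. *)
Lemma torsion_zero_iff (a b : R) (s w k tau : R -> R) :
  profile a b s w -> (forall t, 0 < a ^ 2 + b ^ 2 + 1 - 2 * s t) ->
  (forall t, k t ^ 2 = a ^ 2 + 1 - 2 * s t) ->
  (forall t, 2 * (k t ^ 2 * tau t) = b * (k t ^ 2 + a ^ 2 - 1)) ->
  (forall t, tau t = 0) <-> b = 0 \/ a = 0.
Proof.
  intros P Hr Hk Htau; split.
  - intros H0.
    destruct (Req_dec b 0) as [ | Hb]; [now left | right].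
    apply (constant_curvature_circle a b (a ^ 2) s w); trivial.
    intros t; specialize (Htau t); rewrite H0 in Htau; rewrite Hk in Htau.
    apply Rmult_eq_reg_l with b; trivial; lra.
  - intros Hab t.
    assert (E : k t ^ 2 * tau t = 0 /\ 0 < k t ^ 2).
    { specialize (Htau t); specialize (Hk t).
      destruct Hab as [-> | ->].
      - specialize (Hr t); nra.
      - destruct (circle_profile b s w P Hr t) as [Hs _].
        assert (Hk1 : k t ^ 2 = 1) by lra.
        rewrite Hk1 in *; lra. }
    destruct E as [E Hpos]; apply Rmult_integral in E as [E | ]; lra.
Qed.

(** The first two derivatives of [k ^ 2 = a ^ 2 + 1 - 2 s], halved. *)
Lemma curvature_derivatives (a b : R) (s w k k1 k2 : R -> R) :
  profile a b s w -> (forall t, k t ^ 2 = a ^ 2 + 1 - 2 * s t) ->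
  (forall t, is_derive k t (k1 t)) -> (forall t, is_derive k1 t (k2 t)) ->
  forall t, k t * k1 t = w t * (k t ^ 2 + b ^ 2) /\
    k1 t ^ 2 + k t * k2 t = (s t + w t ^ 2) * (k t ^ 2 + b ^ 2).
Proof.
  intros P Hk D1 D2.
  assert (E1 : forall t, k t * k1 t = w t * (a ^ 2 + b ^ 2 + 1 - 2 * s t)).
  { intros t.
    assert (H1 := is_derive_mult_R _ _ _ _ _ (D1 t) (D1 t)).
    assert (H2 : is_derive (fun u => k u * k u) t
              (2 * (w t * (a ^ 2 + b ^ 2 + 1 - 2 * s t)))).
    { apply is_derive_ext with (fun u => a ^ 2 + 1 - 2 * s u).
      - intros u; rewrite <- Hk; apply (eq_sym (Rsqr_pow2 (k u))).
      - assert (h := profile_ds P t).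
        auto_derive; [now eexists; apply h | ].
        rewrite_Derive h; ring. }
    assert (E := is_derive_R_unique _ _ _ _ H1 H2); lra. }
  intros t.
  assert (ER : k t ^ 2 + b ^ 2 = a ^ 2 + b ^ 2 + 1 - 2 * s t) by (rewrite Hk; ring).
  rewrite ER; split; trivial.
  assert (H1 := is_derive_mult_R _ _ _ _ _ (D1 t) (D2 t)).
  assert (H2 : is_derive (fun u => k u * k1 u) t
            ((s t + w t ^ 2) * (a ^ 2 + b ^ 2 + 1 - 2 * s t))).
  { apply is_derive_ext with (fun u => w u * (a ^ 2 + b ^ 2 + 1 - 2 * s u)).
    - intros u; now rewrite E1.
    - assert (h := profile_ds P t); assert (h' := profile_dw P t).
      auto_derive; [split; [ | split]; trivial; eexists; [apply h' | apply h] | ].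
      rewrite_Derive h; rewrite_Derive h'.
      ring. }
  assert (E := is_derive_R_unique _ _ _ _ H1 H2); lra.
Qed.

Lemma planar_curvature_equation (a b : R) (s w k k1 k2 : R -> R) :
  profile a b s w -> (forall t, 0 < a ^ 2 + b ^ 2 + 1 - 2 * s t) ->
  (forall t, k t ^ 2 = a ^ 2 + 1 - 2 * s t) ->
  (forall t, is_derive k t (k1 t)) -> (forall t, is_derive k1 t (k2 t)) ->
  b = 0 \/ a = 0 ->
  forall t, k t <> 0 /\ k2 t + 1 / 2 * k t ^ 3 + - ((a ^ 2 + 1) / 2) * k t = 0.
Proof.
  intros P Hr Hk D1 D2 Hab t.
  destruct (curvature_derivatives a b s w k k1 k2 P Hk D1 D2 t) as [E1 E2].
  assert (HE := profile_energy P t).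
  assert (Hkt := Hk t); assert (Hrt := Hr t).
  destruct Hab as [-> | ->].
  - assert (Hk0 : k t <> 0) by nra.
    split; trivial.
    replace (s t) with ((a ^ 2 + 1 - k t ^ 2) / 2) in * by lra.
    assert (E3 : k1 t = w t * k t)
      by (apply Rmult_eq_reg_l with (k t); trivial; rewrite E1; ring).
    rewrite E3 in E2.
    apply Rmult_eq_reg_l with (k t); trivial; lra.
  - destruct (circle_profile b s w P Hr t) as [Hs Hw]; rewrite Hs, Hw in *.
    assert (Hk1 : k t ^ 2 = 1) by lra.
    assert (Hk0 : k t <> 0) by nra.
    split; trivial.
    assert (E3 : k1 t = 0) by (apply Rmult_eq_reg_l with (k t); trivial; lra).
    rewrite E3 in E2.
    assert (E4 : k2 t = 0) by (apply Rmult_eq_reg_l with (k t); trivial; lra).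
    rewrite E4; replace (k t ^ 3) with (k t ^ 2 * k t) by ring; rewrite Hk1; lra.
Qed.

(** Both identities hold where [k <> 0], by eliminating [w] with the first integral, and extend
    to the inflections by continuity. *)
Lemma constant_torsion_curvature_equation (b : R) (s w k k1 k2 : R -> R) :
  profile 1 b s w -> (forall t, 0 < 1 ^ 2 + b ^ 2 + 1 - 2 * s t) ->
  (forall t, k t ^ 2 = 1 ^ 2 + 1 - 2 * s t) ->
  (forall t, is_derive k t (k1 t)) -> (forall t, is_derive k1 t (k2 t)) ->
  (forall t, continuous k2 t) ->
  forall t, k1 t ^ 2 = (k t ^ 2 + b ^ 2) * (4 - k t ^ 2) / 4 /\
    k2 t = k t * (4 - b ^ 2 - 2 * k t ^ 2) / 4.
Proof.
  intros P Hr Hk D1 D2 C2.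
  assert (F : forall t, k t <> 0 ->
    k1 t ^ 2 - (k t ^ 2 + b ^ 2) * (4 - k t ^ 2) / 4 = 0 /\
    k2 t - k t * (4 - b ^ 2 - 2 * k t ^ 2) / 4 = 0).
  { intros t Hk0.
    destruct (curvature_derivatives 1 b s w k k1 k2 P Hk D1 D2 t) as [E1 E2].
    assert (HE := profile_energy P t); assert (Hkt := Hk t).
    replace (1 ^ 2 + b ^ 2 + 1 - 2 * s t) with (k t ^ 2 + b ^ 2) in HE by lra.
    replace (s t) with (1 - k t ^ 2 / 2) in * by lra.
    assert (E3 : k1 t ^ 2 = (k t ^ 2 + b ^ 2) * (4 - k t ^ 2) / 4).
    { apply Rmult_eq_reg_l with (k t ^ 2); [ | now apply pow_nonzero].
      transitivity ((k t * k1 t) ^ 2); [ring | rewrite E1].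
      transitivity ((k t ^ 2 + b ^ 2) * (w t ^ 2 * (k t ^ 2 + b ^ 2))); [ring | rewrite HE; field]. }
    split; [lra | ].
    apply Rmult_eq_reg_l with (k t); trivial.
    rewrite E3 in E2; lra. }
  assert (Dk : forall t, ex_derive k t) by (intros t; eexists; apply D1).
  assert (Dk1 : forall t, ex_derive k1 t) by (intros t; eexists; apply D2).
  assert (S := fun g => curvature_zeros_sparse 1 b s w k g P Rle_0_1 Hr Hk).
  intros t; split; apply Rminus_diag_uniq; revert t; apply S.
  - intros t; apply (ex_derive_continuous (V := R_NormedModule)); auto_derive; auto.
  - intros t Hk0; now apply F.
  - intros t; apply (continuous_minus (V := R_NormedModule)); [apply C2 | ].
    apply (ex_derive_continuous (V := R_NormedModule)); auto_derive; auto.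
  - intros t Hk0; now apply F.
Qed.

(** Put [Y = k' / (k ^ 2 + b ^ 2)].  The two equations give
    [Y' = - k (4 + b ^ 2) / (4 (k ^ 2 + b ^ 2))], so [Y] decreases strictly while [k > 0], and
    it takes a nonzero value.  If [Y t < 0], then [k' <= Y t * b ^ 2 < 0] from [t] on; if
    [Y t > 0], then [k' >= Y t * b ^ 2 > 0] up to [t].  Either way [k] reaches zero. *)
Lemma curvature_not_positive (b : R) (k k1 k2 : R -> R) :
  0 < b ->
  (forall t, is_derive k t (k1 t)) -> (forall t, is_derive k1 t (k2 t)) ->
  (forall t, k1 t ^ 2 = (k t ^ 2 + b ^ 2) * (4 - k t ^ 2) / 4) ->
  (forall t, k2 t = k t * (4 - b ^ 2 - 2 * k t ^ 2) / 4) ->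
  ~ (forall t, 0 < k t).
Proof.
  intros Hb D1 D2 E1 E2 Hk.
  set (Y := fun t => k1 t / (k t ^ 2 + b ^ 2)).
  assert (HR : forall t, 0 < k t ^ 2 + b ^ 2) by (intros; nra).
  assert (DY : forall t, is_derive Y t (- (k t * (4 + b ^ 2) / (4 * (k t ^ 2 + b ^ 2))))).
  { intros t; specialize (HR t); unfold Y.
    auto_derive.
    { split; [exists (k2 t); apply D2 | split; [exists (k1 t); apply D1 | split; trivial; lra]]. }
    rewrite_Derive (D1 t); rewrite_Derive (D2 t).
    rewrite E2.
    transitivity ((k t * (4 - b ^ 2 - 2 * k t ^ 2) / 4 * (k t ^ 2 + b ^ 2)
      - 2 * k t * k1 t ^ 2) / (k t ^ 2 + b ^ 2) ^ 2); [field; lra | ].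
    rewrite E1; field; lra. }
  assert (Ydec : forall t u, t <= u -> Y u <= Y t).
  { intros t u h; apply (nonincreasing_of_derive _ _ _ _ DY h).
    intros z _; apply Ropp_le_cancel; rewrite Ropp_involutive, Ropp_0.
    specialize (Hk z); specialize (HR z).
    apply Rdiv_le_0_compat; nra. }
  assert (EY : forall t, k1 t = Y t * (k t ^ 2 + b ^ 2))
    by (intros t; specialize (HR t); unfold Y; field; lra).
  assert (Hneg : forall t, ~ Y t < 0).
  { intros t HY.
    (* [u] is the time at which the line through [(t, k t)] of slope [Y t * b ^ 2] meets the axis. *)
    set (u := t + k t / (- Y t * b ^ 2)).
    assert (Hc : 0 < - Y t * b ^ 2) by (apply Rmult_lt_0_compat; nra).
    assert (Hu : t <= u).
    { unfold u; assert (0 < k t / (- Y t * b ^ 2)) by now apply Rdiv_lt_0_compat. lra. }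
    assert (L : k u - Y t * b ^ 2 * u <= k t - Y t * b ^ 2 * t).
    { apply (nonincreasing_of_derive (fun z => k z - Y t * b ^ 2 * z)
               (fun z => k1 z - Y t * b ^ 2)); trivial.
      - intros z; auto_derive; [exists (k1 z); apply D1 | ].
        rewrite_Derive (D1 z); ring.
      - intros z [hz _]; rewrite EY.
        specialize (Ydec _ _ hz); nra. }
    assert (E : k t - (- Y t * b ^ 2) * (u - t) = 0) by (unfold u; field; nra).
    specialize (Hk u); lra. }
  assert (Hpos : forall t, ~ 0 < Y t).
  { intros t HY.
    set (u := t - k t / (Y t * b ^ 2)).
    assert (Hc : 0 < Y t * b ^ 2) by (apply Rmult_lt_0_compat; nra).
    assert (Hu : u <= t).
    { unfold u; assert (0 < k t / (Y t * b ^ 2)) by now apply Rdiv_lt_0_compat. lra. }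
    assert (L : - k t + Y t * b ^ 2 * t <= - k u + Y t * b ^ 2 * u).
    { apply (nonincreasing_of_derive (fun z => - k z + Y t * b ^ 2 * z)
               (fun z => - k1 z + Y t * b ^ 2)); trivial.
      - intros z; auto_derive; [exists (k1 z); apply D1 | ].
        rewrite_Derive (D1 z); ring.
      - intros z [_ hz]; rewrite EY.
        specialize (Ydec _ _ hz); nra. }
    assert (E : k t - Y t * b ^ 2 * (t - u) = 0) by (unfold u; field; nra).
    specialize (Hk u); lra. }
  assert (HY0 : forall t, Y t = 0) by (intros t; specialize (Hneg t); specialize (Hpos t); lra).
  assert (E := is_derive_const_0 HY0 (DY 0)).
  assert (0 < k 0 * (4 + b ^ 2) / (4 * (k 0 ^ 2 + b ^ 2)))
    by (specialize (Hk 0); specialize (HR 0); apply Rdiv_lt_0_compat; nra).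
  lra.
Qed.

(** By the intermediate value theorem a curvature without zeros has a sign, and the equations are
    invariant under [k -> - k]. *)
Lemma curvature_vanishes (b : R) (k k1 k2 : R -> R) :
  0 < b ->
  (forall t, is_derive k t (k1 t)) -> (forall t, is_derive k1 t (k2 t)) ->
  (forall t, k1 t ^ 2 = (k t ^ 2 + b ^ 2) * (4 - k t ^ 2) / 4) ->
  (forall t, k2 t = k t * (4 - b ^ 2 - 2 * k t ^ 2) / 4) ->
  exists t, k t = 0.
Proof.
  intros Hb D1 D2 E1 E2.
  assert (C : forall t, continuity_pt k t)
    by (intros t; apply continuity_pt_filterlim, (ex_derive_continuous k); eexists; apply D1).
  apply NNPP; intros Hn.
  assert (H0 : forall t, k t <> 0) by (intros t h; apply Hn; now exists t).
  assert (Hsign : (forall t, 0 < k t) \/ (forall t, k t < 0)).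
  { assert (Hivt : forall t u, k t < 0 -> 0 < k u -> False).
    { intros t u ht hu.
      destruct (IVT_gen k t u 0) as (z & _ & hz); trivial.
      - rewrite Rmin_left, Rmax_right; lra.
      - now apply (H0 z). }
    destruct (Rlt_le_dec 0 (k 0)) as [h | h]; [left | right]; intros t;
      destruct (Rtotal_order (k t) 0) as [h' | [h' | h']]; trivial; exfalso;
      try now apply (H0 t).
    - now apply (Hivt t 0).
    - apply (Hivt 0 t); trivial; specialize (H0 0); lra. }
  destruct Hsign as [H | H].
  - now apply (curvature_not_positive b k k1 k2).
  - apply (curvature_not_positive b (fun t => - k t) (fun t => - k1 t) (fun t => - k2 t)); trivial.
    + intros t; apply (is_derive_opp (V := R_NormedModule)), D1.
    + intros t; apply (is_derive_opp (V := R_NormedModule)), D2.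
    + intros t; rewrite <- !Rsqr_pow2, <- !Rsqr_neg, !Rsqr_pow2; apply E1.
    + intros t; rewrite E2; field.
    + intros t; specialize (H t); lra.
Qed.

(** * Frames and planes *)

(** The determinant of [(T, T', T'')]: the terms of [T''] along [T] and [T'] drop out, and
    what is left is a combination of [r] and [v], so only [det (T, r, v) = - det (p, v, T)] matters. *)
Lemma torsion_det (p T v : vec) (w w' s s' : R) :
  let A := minus (scal w (minus T p)) (scal (1 - s) v) in
  dot (minus (plus (scal w' (minus T p)) (scal w A))
         (plus (scal (- s') v) (scal (1 - s) (minus T (scal w v)))))
    (cross T A) =
  - dot p (cross v T) * (w * (s' + (1 - s) * w) + (1 - s) * w').
Proof. intros A; unfold A; vec_ring. Qed.

Lemma frenet_motion (x T v T0 N B : R -> vec) (p : vec) (a b : R) (k tau : R -> R) :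
  motion x T v p a b -> frenet_frame x T0 N B k tau ->
  (forall t, T0 t = T t) /\
  (forall t, scal (k t) (N t) = accel p (T t) (v t)).
Proof.
  intros M [_ F].
  assert (E : forall t, T0 t = T t).
  { intros t; apply (is_derive_vec_unique x t); [ | apply (motion_dx M)].
    now destruct (F t) as (_ & _ & _ & _ & h & _). }
  split; trivial; intros t.
  apply (is_derive_vec_unique T t); [ | apply (motion_dT M)].
  apply is_derive_ext with T0; [exact E | now destruct (F t) as (_ & _ & _ & _ & _ & h & _)].
Qed.

Lemma curvature_formula {x T v : R -> vec} {p : vec} {a b : R} {k tau : R -> R} :
  motion x T v p a b -> curvature_torsion x k tau ->
  forall t, k t ^ 2 = a ^ 2 + 1 - 2 * dot (T t) p.
Proof.
  intros M (T0 & N & B & F) t.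
  destruct (frenet_motion _ _ _ _ _ _ _ _ _ _ _ M F) as [_ EA].
  rewrite <- (accel_norm M), <- EA.
  destruct F as [_ F]; destruct (F t) as (_ & HN & _).
  apply enorm_1_iff in HN.
  transitivity (k t ^ 2 * dot (N t) (N t)); [rewrite HN; ring | vec_ring].
Qed.

(** Differentiating [T' . B = 0] gives [T'' . B = k tau], and [k B = T x T'] turns
    [k ^ 2 tau] into the determinant of [torsion_det].  No derivative of [k] or [N] enters. *)
Lemma torsion_formula {x T v : R -> vec} {p : vec} {a b : R} {k tau : R -> R} :
  motion x T v p a b -> curvature_torsion x k tau ->
  forall t, 2 * (k t ^ 2 * tau t) = b * (k t ^ 2 + a ^ 2 - 1).
Proof.
  intros M H t.
  assert (HK := curvature_formula M H t).
  destruct H as (T0 & N & B & F).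
  destruct (frenet_motion _ _ _ _ _ _ _ _ _ _ _ M F) as [ET EA].
  assert (P := motion_profile M).
  set (s := fun t => dot (T t) p) in *; set (w := fun t => dot (v t) p) in *.
  assert (Hs := profile_ds P t); assert (Hw := profile_dw P t).
  set (s' := - (w t * (a ^ 2 + b ^ 2 + 1 - 2 * s t))) in *.
  set (w' := s t - w t ^ 2) in *.
  set (A := accel p (T t) (v t)).
  set (D := minus (plus (scal w' (minus (T t) p)) (scal (w t) A))
         (plus (scal (- s') (v t)) (scal (1 - s t) (minus (T t) (scal (w t) (v t)))))).
  assert (HD : is_derive (fun u => accel p (T u) (v u)) t D).
  { apply (is_derive_minus (V := vec) (fun u => scal (w u) (minus (T u) p))
             (fun u => scal (1 - s u) (v u))).
    - apply (is_derive_scal_vec w (fun u => minus (T u) p)); trivial.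
      eapply is_derive_eq; [apply (is_derive_minus (V := vec) T (fun _ => p)) | ].
      + apply (motion_dT M).
      + apply (is_derive_const p).
      + apply vec_ext; unfold A; vec_ring.
    - apply (is_derive_scal_vec (fun u => 1 - s u) v); [ | apply (motion_dv M)].
      auto_derive; [now exists s' | rewrite_Derive Hs; ring]. }
  destruct F as [_ F].
  assert (HAB : forall u, dot (accel p (T u) (v u)) (B u) = 0).
  { intros u; rewrite <- EA; destruct (F u) as (_ & _ & _ & -> & _); vec_ring. }
  destruct (F t) as (_ & HN & _ & HB & _ & _ & _ & dB).
  assert (E := is_derive_const_0 HAB (is_derive_dot _ _ _ _ _ HD dB)).
  cbv beta in E; rewrite <- EA in E; apply enorm_1_iff in HN.
  assert (E1 : dot D (B t) = k t * tau t).
  { assert (E2 : dot (scal (k t) (N t)) (scal (- tau t) (N t)) = - (k t * tau t) * dot (N t) (N t))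
      by vec_ring.
    rewrite E2, HN in E; lra. }
  assert (E3 : k t * dot D (B t) = dot D (cross (T t) A)).
  { rewrite HB, ET; unfold A; rewrite <- EA; vec_ring. }
  rewrite E1 in E3.
  assert (E4 := torsion_det p (T t) (v t) (w t) w' (s t) s').
  fold (accel p (T t) (v t)) in E4.
  change (dot D (cross (T t) A) = - dot p (cross (v t) (T t))
    * (w t * (s' + (1 - s t) * w t) + (1 - s t) * w')) in E4.
  rewrite E4, (motion_b M) in E3.
  assert (HE := profile_energy P t).
  change (k t ^ 2 = a ^ 2 + 1 - 2 * s t) in HK.
  transitivity (2 * (k t * (k t * tau t))); [ring | rewrite E3].
  rewrite HK; unfold s', w'.
  transitivity (- 2 * b * (- (w t ^ 2 * (a ^ 2 + b ^ 2 + 1 - 2 * s t)) + s t - s t ^ 2));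
    [ring | rewrite HE; ring].
Qed.

Lemma in_plane_tangent (n : vec) (c : R) (x T : R -> vec) :
  in_plane n c x -> (forall t, is_derive x t (T t)) -> forall t, dot n (T t) = 0.
Proof.
  intros [_ Hn] D t.
  exact (is_derive_const_0 Hn (is_derive_dot_l n _ _ _ (D t))).
Qed.

(** When [tau = 0] the binormal is constant; it is the normal of the plane. *)
Lemma torsion_zero_planar (x : R -> vec) (k tau : R -> R) :
  curvature_torsion x k tau -> (forall t, tau t = 0) -> planar x.
Proof.
  intros (T & N & B & [_ F]) Hz.
  assert (HB : forall t, B t = B 0).
  { apply derive_zero_const; intros t.
    apply (is_derive_eq _ _ (scal (- tau t) (N t)));
      [now destruct (F t) as (_ & _ & _ & _ & _ & _ & _ & h) | ].
    rewrite Hz; apply vec_ext; vec_ring. }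
  exists (B 0), (dot (B 0) (x 0)).
  destruct (F 0) as (HT & HN & HTN & HB0 & _).
  apply enorm_1_iff in HT, HN.
  split.
  - intros E.
    assert (G := gram_det (B 0) (T 0) (N 0)).
    rewrite <- HB0 in G.
    assert (G' : dot (B 0) (B 0) = 1).
    { rewrite HB0.
      transitivity (dot (T 0) (T 0) * dot (N 0) (N 0) - dot (T 0) (N 0) ^ 2);
        [vec_ring | rewrite HT, HN, HTN; ring]. }
    rewrite E in G'; revert G'; vec_simpl; lra.
  - apply (derive_zero_const (fun t => dot (B 0) (x t))); intros t.
    apply (is_derive_eq _ _ (dot (B 0) (T t))).
    + apply is_derive_dot_l; now destruct (F t) as (_ & _ & _ & _ & h & _).
    + rewrite <- (HB t); destruct (F t) as (_ & _ & _ & -> & _); vec_ring.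
Qed.

(** A normal [n] of the plane is orthogonal to [T], hence to [k N], hence to [N] as inflections
    are isolated.  Differentiating [n . N = 0] leaves [tau (n . B) = 0], and
    [(n . B) ^ 2 = n . n] is not zero. *)
Lemma planar_torsion_zero (x T v : R -> vec) (p : vec) (a b : R) (k tau : R -> R) :
  motion x T v p a b -> ~ straight_line x -> curvature_torsion x k tau ->
  planar x -> forall t, tau t = 0.
Proof.
  intros M Hx H (n & c & Hn).
  assert (P := motion_profile M).
  assert (Hr := motion_r_pos M Hx).
  assert (HK := curvature_formula M H).
  destruct H as (T0 & N & B & [_ F]).
  assert (HT : forall t, dot n (T0 t) = 0)
    by (apply (in_plane_tangent n c x); trivial;
        intros t; now destruct (F t) as (_ & _ & _ & _ & h & _)).
  assert (HN : forall t, dot n (N t) = 0).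
  { apply (curvature_zeros_sparse a b (fun t => dot (T t) p) (fun t => dot (v t) p) k); trivial.
    - apply (motion_a0 M).
    - intros t; apply (ex_derive_continuous (V := R_NormedModule)).
      destruct (F t) as (_ & _ & _ & _ & _ & _ & h & _).
      eexists; apply is_derive_dot_l, h.
    - intros t Hk.
      destruct (F t) as (_ & _ & _ & _ & _ & dT & _).
      assert (E := is_derive_const_0 HT (is_derive_dot_l n _ _ _ dT)).
      apply Rmult_eq_reg_l with (k t); trivial.
      rewrite Rmult_0_r, <- E; vec_ring. }
  intros t.
  destruct (F t) as (hT & hN & hTN & hB & _ & _ & dN & _).
  assert (E := is_derive_const_0 HN (is_derive_dot_l n _ _ _ dN)).
  apply enorm_1_iff in hT, hN.
  assert (G := gram_det n (T0 t) (N t)).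
  assert (S : forall u u' : vec, dot u u' = dot u' u) by vec_ring.
  rewrite <- hB, hT, hN, (S (N t) (T0 t)), hTN, (S (T0 t) n), (S (N t) n), HT, HN in G.
  assert (E' : tau t * dot n (B t) = 0).
  { rewrite <- E.
    transitivity (- k t * dot n (T0 t) + tau t * dot n (B t)); [rewrite HT; ring | vec_ring]. }
  apply Rmult_integral in E' as [ | E']; trivial; exfalso.
  apply (proj1 Hn), dot_self_0; rewrite E' in G; lra.
Qed.

Lemma gram_det_product (n p T A : vec) :
  dot p (cross T A) * dot n (cross T A) =
  dot n p * (dot T T * dot A A - dot T A ^ 2)
  - dot p T * (dot n T * dot A A - dot T A * dot n A)
  + dot p A * (dot n T * dot T A - dot T T * dot n A).
Proof. vec_ring. Qed.

(** A normal [n] is orthogonal to [T] and to [T'], and [det (p, T, T') = (1 - s) b = 0], so the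
    product of the determinants of [(p, T, T')] and [(n, T, T')] reduces to
    [(n . p) |T'|^2 = 0]. *)
Lemma plane_parallel_to_p (x T v : R -> vec) (p : vec) (a : R) (n : vec) (c : R) :
  motion x T v p a 0 -> ~ straight_line x -> in_plane n c x -> dot n p = 0.
Proof.
  intros M Hx Hn.
  assert (HT := in_plane_tangent n c x T Hn (motion_dx M)).
  assert (HA := is_derive_const_0 HT (is_derive_dot_l n _ _ _ (motion_dT M 0))).
  assert (Hr := motion_r_pos M Hx 0).
  assert (HK := accel_norm M 0).
  assert (Hb := motion_b M 0).
  assert (H1 := motion_T1 M 0).
  assert (HTA : dot (T 0) (accel p (T 0) (v 0)) = 0).
  { transitivity (dot (v 0) p * (dot (T 0) (T 0) - dot (T 0) p) - (1 - dot (T 0) p) * dot (T 0) (v 0));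
      [unfold accel; vec_ring | ].
    rewrite H1, (motion_Tv M); ring. }
  assert (G := gram_det_product n p (T 0) (accel p (T 0) (v 0))).
  assert (E : dot p (cross (T 0) (accel p (T 0) (v 0))) = (1 - dot (T 0) p) * dot p (cross (v 0) (T 0)))
    by (unfold accel; vec_ring).
  rewrite E, Hb, HT, HA, HTA, H1, HK in G.
  assert (G' : dot n p * (a ^ 2 + 1 - 2 * dot (T 0) p) = 0) by lra.
  apply Rmult_integral in G' as [ | G']; trivial; lra.
Qed.

(** Everything orthogonal to the direction [d] is orthogonal to [T] and [T'].  So [T] is
    parallel to [d]; then [T . T' = 0] makes [T'] itself orthogonal to [d], hence to [T']. *)
Lemma straight_line_accel (x T T' : R -> vec) :
  straight_line x -> (forall t, is_derive x t (T t)) -> (forall t, is_derive T t (T' t)) ->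
  (forall t, dot (T t) (T t) = 1) -> forall t, T' t = zero.
Proof.
  intros (q & d & H) D D' H1 t.
  assert (E : forall n, dot n d = 0 -> dot n (T t) = 0 /\ dot n (T' t) = 0).
  { intros n Hn.
    assert (Hc : forall u, dot n (x u) = dot n q).
    { intros u; destruct (H u) as [s ->].
      transitivity (dot n q + s * dot n d); [vec_ring | rewrite Hn; ring]. }
    assert (HT : forall u, dot n (T u) = 0)
      by (intros u; exact (is_derive_const_0 Hc (is_derive_dot_l n _ _ _ (D u)))).
    split; trivial.
    exact (is_derive_const_0 HT (is_derive_dot_l n _ _ _ (D' t))). }
  assert (HTT : dot (T t) (T' t) = 0).
  { assert (h := is_derive_const_0 H1 (is_derive_dot _ _ _ _ _ (D' t) (D' t))).
    revert h; vec_simpl; lra. }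
  assert (Hpar : cross (T t) d = zero).
  { apply dot_self_0.
    destruct (E (cross d (cross (T t) d))) as [h _]; [vec_ring | ].
    rewrite <- h; vec_ring. }
  assert (Hd : dot (T' t) d = 0).
  { transitivity (dot (T t) (T t) * dot (T' t) d - dot (T t) (T' t) * dot (T t) d);
      [rewrite HTT, H1; ring | ].
    transitivity (dot (cross (T t) d) (cross (T t) (T' t))); [vec_ring | ].
    rewrite Hpar; vec_ring. }
  apply dot_self_0, E, Hd.
Qed.

(** On a straight line [k = 0], i.e. [2 s = a ^ 2 + 1] for all times.  If [b] were nonzero, [R = b ^ 2]
    would be positive, and a constant [s] would give [a = s = 0], which contradicts [2 s = 1]; with [b = 0] the first
    integral says [a ^ 2 = s ^ 2]. *)
Lemma straight_line_parameters (x T v : R -> vec) (p : vec) (a b : R) :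
  motion x T v p a b -> straight_line x -> a = 1 /\ b = 0.
Proof.
  intros M Hx.
  assert (P := motion_profile M).
  assert (Ha := motion_a0 M).
  assert (HK : forall t, a ^ 2 + 1 - 2 * dot (T t) p = 0).
  { intros t; rewrite <- (accel_norm M).
    rewrite (straight_line_accel x T (fun t => accel p (T t) (v t)) Hx).
    - vec_ring.
    - apply (motion_dx M).
    - apply (motion_dT M).
    - apply (motion_T1 M). }
  assert (Hb : b = 0).
  { destruct (Req_dec b 0) as [ | Hb]; trivial; exfalso.
    assert (Hr : forall t, 0 < a ^ 2 + b ^ 2 + 1 - 2 * dot (T t) p).
    { intros t; specialize (HK t); assert (h := Rsqr_pos_lt b Hb).
      rewrite Rsqr_pow2 in h; lra. }
    assert (Ea : a = 0)
      by (apply (constant_curvature_circle a b ((a ^ 2 + 1) / 2) _ _ P Hr);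
          intros t; specialize (HK t); lra).
    subst a; destruct (circle_profile b _ _ P Hr 0) as [h _]; specialize (HK 0); lra. }
  split; trivial; subst b.
  assert (HE := profile_energy P 0); cbn beta in HE.
  specialize (HK 0).
  replace (dot (T 0) p) with ((a ^ 2 + 1) / 2) in HE by lra.
  assert (E : (a ^ 2 - 1)² = 0) by (unfold Rsqr; lra).
  apply Rsqr_0_uniq in E.
  assert (E' : (a - 1) * (a + 1) = 0) by lra.
  apply Rmult_integral in E'; lra.
Qed.

(** For [a = 0] one has [w = 0], so [v' = T = x'] and the back wheel does not move. *)
Lemma circle_of_a_eq_0 (x y T : R -> vec) (p : vec) (b : R) :
  motion x T (fun t => minus (x t) (y t)) p 0 b -> ~ straight_line x -> circle_normal_to x y p.
Proof.
  intros M Hx.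
  assert (P := motion_profile M).
  assert (Hr := motion_r_pos M Hx).
  assert (Hw : forall t, dot (minus (x t) (y t)) p = 0)
    by (intros t; apply (circle_profile b _ _ P Hr t)).
  assert (Hy : forall t, y t = y 0).
  { apply derive_zero_const; intros t.
    apply is_derive_ext with (fun u => minus (x u) (minus (x u) (y u))).
    - intros u; apply vec_ext; vec_ring.
    - eapply is_derive_eq; [apply (is_derive_minus (V := vec) x (fun u => minus (x u) (y u))) | ].
      + apply (motion_dx M).
      + apply (motion_dv M).
      + cbv beta; rewrite Hw; apply vec_ext; vec_ring. }
  exists (y 0); intros t; rewrite <- (Hy t).
  split; [reflexivity | split].
  - apply enorm_1_iff, (motion_v1 M t).
  - rewrite <- (Hw t); vec_ring.
Qed.

(** * Planar curves with prescribed elastic curvature *)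

(** Along an elastica [(k ^ 2 / 2 + A) T + k' N] is constant, of length [J].  Taking it along the
    first axis determines the components of [T] and [N]. *)
Lemma frenet_frame_elastica (x : R -> vec) (k : R -> R) (A J : R) :
  analytic k -> J <> 0 ->
  (forall t, (k t ^ 2 / 2 + A) ^ 2 + Derive k t ^ 2 = J ^ 2) ->
  (forall t, Derive (Derive k) t = - (k t * (k t ^ 2 / 2 + A))) ->
  (forall t, is_derive x t (vec3 (/ J * (k t ^ 2 / 2 + A)) (/ J * (- Derive k t)) 0)) ->
  curvature_torsion x k (fun _ => 0).
Proof.
  intros Hk HJ HE H2 Dx.
  set (q := fun t => k t ^ 2 / 2 + A).
  assert (D1 : forall t, is_derive k t (Derive k t))
    by (intros t; now apply Derive_correct, analytic_ex_derive).
  assert (D2 : forall t, is_derive (Derive k) t (- (k t * q t))).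
  { intros t; unfold q; rewrite <- H2.
    now apply Derive_correct, analytic_ex_derive, analytic_Derive. }
  assert (Dq : forall t, is_derive q t (k t * Derive k t)).
  { intros t; unfold q; auto_derive; [now exists (Derive k t) | ].
    rewrite_Derive (D1 t); field. }
  assert (Aq : analytic (fun t => / J * q t)).
  { apply analytic_scal, analytic_plus; [ | apply analytic_const].
    apply (analytic_ext (fun t => / 2 * (k t * k t))); [intros t; field | ].
    now apply analytic_scal, analytic_mult. }
  assert (Ak : forall c, analytic (fun t => c * Derive k t))
    by (intros c; now apply analytic_scal, analytic_Derive).
  assert (S : forall (f : R -> R) (c t l : R), is_derive f t l -> is_derive (fun u => c * f u) t (c * l))
    by (intros f c t l H; now apply (is_derive_scal f t c l)).
  exists (fun t => vec3 (/ J * q t) (/ J * (- Derive k t)) 0),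
    (fun t => vec3 (/ J * Derive k t) (/ J * q t) 0), (fun _ => vec3 0 0 1).
  assert (HN : forall t, (/ J * q t) ^ 2 + (/ J * Derive k t) ^ 2 = 1).
  { intros t; transitivity ((q t ^ 2 + Derive k t ^ 2) / J ^ 2); [now field | ].
    unfold q; rewrite HE; now field. }
  split.
  - assert (Am : analytic (fun t => / J * - Derive k t))
      by (apply (analytic_ext (fun t => - / J * Derive k t)); [intros t; ring | apply Ak]).
    unfold analytic_vec; cbn.
    split; [ | split; [ | split; [ | split]]]; trivial; try apply analytic_const;
      (split; [ | split]); trivial; apply analytic_const.
  - intros t; specialize (HN t).
    split; [ | split; [ | split; [ | split; [ | split; [ | split; [ | split]]]]]].
    + apply enorm_1_iff; rewrite <- HN; vec_ring.
    + apply enorm_1_iff; rewrite <- HN; vec_ring.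
    + vec_ring.
    + apply vec_ext; try vec_ring; rewrite <- HN at 1; vec_ring.
    + apply Dx.
    + apply is_derive_vec_iff; split; [ | split].
      * eapply is_derive_eq; [apply S, Dq | vec_ring].
      * eapply is_derive_eq; [apply S, (is_derive_opp (V := R_NormedModule)), D2 | vec_ring].
      * eapply is_derive_eq; [apply (is_derive_const 0) | vec_ring].
    + apply is_derive_vec_iff; split; [ | split].
      * eapply is_derive_eq; [apply S, D2 | vec_ring].
      * eapply is_derive_eq; [apply S, Dq | vec_ring].
      * eapply is_derive_eq; [apply (is_derive_const 0) | vec_ring].
    + apply (is_derive_eq _ _ zero); [apply (is_derive_const (vec3 0 0 1)) | ].
      apply vec_ext; vec_ring.
Qed.

Lemma elastica_with_curvature (k : R -> R) (A J : R) :
  analytic k -> J <> 0 ->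
  (forall t, (k t ^ 2 / 2 + A) ^ 2 + Derive k t ^ 2 = J ^ 2) ->
  (forall t, Derive (Derive k) t = - (k t * (k t ^ 2 / 2 + A))) ->
  exists z, curvature_torsion z k (fun _ => 0).
Proof.
  intros Hk HJ HE H2.
  set (f := fun t => / J * (k t ^ 2 / 2 + A)).
  assert (Cf : forall t, continuous f t).
  { intros t; apply (ex_derive_continuous (V := R_NormedModule)); unfold f.
    auto_derive; now apply analytic_ex_derive. }
  exists (fun t => vec3 (RInt f 0 t) (/ J * - k t) 0).
  apply frenet_frame_elastica with A J; trivial.
  intros t; apply is_derive_vec_iff; cbn; split; [ | split].
  - apply (is_derive_RInt f (RInt f 0) 0 t); [ | apply Cf].
    apply filter_forall; intros u; apply (RInt_correct (V := R_CompleteNormedModule)).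
    apply (ex_RInt_continuous (V := R_CompleteNormedModule)); intros z _; apply Cf.
  - apply (is_derive_scal (fun u => - k u)), (is_derive_opp (V := R_NormedModule)).
    now apply Derive_correct, analytic_ex_derive.
  - apply (is_derive_const 0).
Qed.

Lemma curvature_of_straight_line (x : R -> vec) (k tau : R -> R) :
  curvature_torsion x k tau -> straight_line x -> forall t, k t = 0.
Proof.
  intros (T & N & B & [_ F]) Hx t.
  assert (E : scal (k t) (N t) = zero).
  { apply (straight_line_accel x T (fun u => scal (k u) (N u)) Hx); intros u;
      destruct (F u) as (hT & _ & _ & _ & dx & dT & _); trivial.
    now apply enorm_1_iff. }
  destruct (F t) as (_ & hN & _); apply enorm_1_iff in hN.
  assert (E' : k t ^ 2 = 0).
  { transitivity (dot (scal (k t) (N t)) (scal (k t) (N t))).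
    - transitivity (k t ^ 2 * dot (N t) (N t)); [rewrite hN; ring | vec_ring].
    - rewrite E; vec_ring. }
  apply Rsqr_0_uniq; now rewrite Rsqr_pow2.
Qed.

(** * Two explicit geodesics *)

Lemma line_geodesic :
  exists x y p, geodesic_with x y p 1 0 /\ straight_line x.
Proof.
  exists (fun t => vec3 t 0 0), (fun t => vec3 (t - 1) 0 0), (vec3 1 0 0).
  assert (Dx : forall t, is_derive (V := vec) (fun t => vec3 t 0 0) t (vec3 1 0 0)).
  { intros t; apply is_derive_vec_iff; cbn; split; [ | split]; auto_derive; trivial. }
  assert (Hv : forall t, minus (vec3 t 0 0) (vec3 (t - 1) 0 0) = vec3 1 0 0)
    by (intros t; apply vec_ext; vec_ring).
  split; [ | exists zero, (vec3 1 0 0); intros t; exists t; apply vec_ext; vec_ring].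
  split; [split | split; [ | split]].
  - intros t; rewrite Hv; split; [eexists; apply Dx | split].
    + apply enorm_1_iff; vec_ring.
    + exists 1; apply is_derive_vec_iff; cbn; split; [ | split];
        auto_derive; trivial; vec_ring.
  - exists (fun _ => zero); intros t; rewrite Hv.
    split; [ | split; [ | split; [ | split; [ | split]]]].
    + eapply is_derive_eq; [apply Dx | apply vec_ext; vec_ring].
    + apply is_derive_ext with (fun _ => vec3 1 0 0); [intros u; symmetry; apply Hv | ].
      eapply is_derive_eq; [apply (is_derive_const (vec3 1 0 0)) | apply vec_ext; vec_ring].
    + eapply is_derive_eq; [apply (is_derive_const (V := vec) zero) | apply vec_ext; vec_ring].
    + apply enorm_1_iff; vec_ring.
    + vec_ring.
    + apply enorm_1_iff; vec_ring.
  - intros E; generalize (f_equal c1 E); vec_simpl; lra.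
  - intros t x' H.
    rewrite (is_derive_vec_unique _ _ _ _ H (Dx t)), Hv; vec_ring.
  - split; [rewrite dot_enorm; vec_ring | lra].
Qed.

Lemma cosh_sinh_sqr (t : R) : cosh t ^ 2 - sinh t ^ 2 = 1.
Proof.
  unfold cosh, sinh.
  transitivity (exp t * exp (- t)); [field | rewrite <- exp_plus, Rplus_opp_r; apply exp_0].
Qed.

Lemma cosh_pos (t : R) : 0 < cosh t.
Proof. unfold cosh; assert (h := exp_pos t); assert (h' := exp_pos (- t)); lra. Qed.

Lemma is_derive_sech (t : R) :
  is_derive (fun u => / cosh u) t (- (sinh t / cosh t ^ 2)).
Proof.
  assert (h := cosh_pos t).
  apply (is_derive_eq_R _ _ (- sinh t / cosh t ^ 2)).
  - apply (is_derive_inv cosh); [apply is_derive_Reals, derivable_pt_lim_cosh | lra].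
  - field; lra.
Qed.

Lemma is_derive_tanh (t : R) :
  is_derive (fun u => sinh u * / cosh u) t (/ cosh t ^ 2).
Proof.
  assert (h := cosh_pos t).
  eapply is_derive_eq_R.
  - apply is_derive_mult_R; [apply is_derive_Reals, derivable_pt_lim_sinh | apply is_derive_sech].
  - transitivity ((cosh t ^ 2 - sinh t ^ 2) / cosh t ^ 2); [field; lra | ].
    rewrite cosh_sinh_sqr; field; lra.
Qed.

(** The curvature and the frame of the soliton are polynomials in [sech] and its derivative. *)
Lemma analytic_sech : analytic (fun t => / cosh t).
Proof.
  apply analytic_inv; [ | intros t; apply Rgt_not_eq, cosh_pos].
  apply (analytic_ext (fun t => / 2 * (exp t + / exp t))).
  - intros t; unfold cosh; rewrite exp_Ropp; field; apply Rgt_not_eq, exp_pos.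
  - apply analytic_scal, analytic_plus; [apply analytic_exp | ].
    apply analytic_inv; [apply analytic_exp | intros t; apply Rgt_not_eq, exp_pos].
Qed.

(** With [S = sech t] and [H = tanh t], the direction [v = (H, - S, 0)] is tangent to the tractrix
    [y = (H - t, - S, 0)], and [p = (- 1, 0, 0)]. *)
Lemma soliton_geodesic :
  exists x y p, geodesic_with x y p 1 0 /\ euler_soliton x.
Proof.
  set (S := fun t => / cosh t); set (H := fun t => sinh t * / cosh t).
  assert (HSH : forall t, S t ^ 2 + H t ^ 2 = 1).
  { intros t; unfold S, H; assert (h := cosh_pos t).
    transitivity ((1 + sinh t ^ 2) / cosh t ^ 2); [field; lra | ].
    replace (1 + sinh t ^ 2) with (cosh t ^ 2) by (generalize (cosh_sinh_sqr t); lra).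
    field; lra. }
  assert (DS : forall t, is_derive S t (- (S t * H t))).
  { intros t; eapply is_derive_eq_R; [apply is_derive_sech | ].
    unfold S, H; field; apply Rgt_not_eq, cosh_pos. }
  assert (DH : forall t, is_derive H t (S t ^ 2)).
  { intros t; eapply is_derive_eq_R; [apply is_derive_tanh | ].
    unfold S; field; apply Rgt_not_eq, cosh_pos. }
  assert (AS : analytic S) by exact analytic_sech.
  assert (S0 : S 0 = 1) by (unfold S; rewrite cosh_0; field).
  assert (ES : forall t, S t = / cosh t) by reflexivity.
  clearbody S H.
  set (x := fun t => vec3 (2 * H t - t) (- 2 * S t) 0).
  set (y := fun t => vec3 (H t - t) (- S t) 0).
  set (T := fun t => vec3 (2 * S t ^ 2 - 1) (2 * (S t * H t)) 0).
  set (p := vec3 (-1) 0 0).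
  assert (Hv : forall t, minus (x t) (y t) = vec3 (H t) (- S t) 0)
    by (intros t; apply vec_ext; unfold x, y; vec_ring).
  assert (eS : forall t, ex_derive S t) by (intros t; eexists; apply DS).
  assert (eH : forall t, ex_derive H t) by (intros t; eexists; apply DH).
  assert (Dx : forall t, is_derive x t (T t)).
  { intros t; apply is_derive_vec_iff; unfold x, T; cbn; split; [ | split]; auto_derive; trivial;
      rewrite_Derive (DS t) || rewrite_Derive (DH t); ring. }
  exists x, y, p; split; [split; [split | split; [ | split]] | ].
  - intros t; rewrite Hv; split; [eexists; apply Dx | split].
    + apply enorm_1_iff; rewrite <- (HSH t); vec_ring.
    + exists (- H t); apply is_derive_vec_iff; unfold y; cbn; split; [ | split];
        auto_derive; trivial.
      * rewrite_Derive (DH t); generalize (HSH t); vec_simpl; lra.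
      * rewrite_Derive (DS t); vec_ring.
      * vec_ring.
  - exists (fun t => vec3 (2 * S t ^ 2) (2 * (S t * H t)) 0); intros t; rewrite Hv.
    split; [ | split; [ | split; [ | split; [ | split]]]].
    + eapply is_derive_eq; [apply Dx | apply vec_ext; unfold T, p; vec_ring].
    + apply is_derive_ext with (fun u => vec3 (H u) (- S u) 0); [intros u; symmetry; apply Hv | ].
      apply is_derive_vec_iff; cbn; split; [ | split]; auto_derive; trivial.
      * rewrite_Derive (DH t).
        transitivity (2 * S t ^ 2 + H t ^ 2 - (S t ^ 2 + H t ^ 2)); [ring | rewrite HSH].
        unfold p; vec_ring.
      * rewrite_Derive (DS t); unfold p; vec_ring.
      * unfold p; vec_ring.
    + apply is_derive_vec_iff; cbn; split; [ | split]; auto_derive; auto.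
      * rewrite_Derive (DS t).
        transitivity (- 4 * S t ^ 2 * H t * (S t ^ 2 + H t ^ 2)); [rewrite HSH; ring | ].
        unfold p; vec_ring.
      * rewrite_Derive (DS t); rewrite_Derive (DH t).
        transitivity (- 2 * S t * H t ^ 2 + 4 * S t ^ 3 * (S t ^ 2 + H t ^ 2) - 2 * S t ^ 3);
          [rewrite HSH; ring | unfold p; vec_ring].
      * unfold p; vec_ring.
    + apply enorm_1_iff; rewrite <- (HSH t); vec_ring.
    + vec_ring.
    + apply enorm_1_iff; unfold p.
      transitivity (1 + 4 * S t ^ 2 * (S t ^ 2 + H t ^ 2 - 1)); [vec_ring | rewrite HSH; ring].
  - intros E; generalize (f_equal c1 E); unfold p; vec_simpl; lra.
  - intros t x' Hx'.
    rewrite (is_derive_vec_unique _ _ _ _ Hx' (Dx t)), Hv; unfold p, T; vec_ring.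
  - split; [rewrite dot_enorm; unfold p; vec_ring | lra].
  - set (k := fun t => 2 * S t).
    assert (Dk : forall t, Derive k t = - 2 * (S t * H t)).
    { intros t; apply is_derive_unique; unfold k; auto_derive; trivial.
      rewrite_Derive (DS t); ring. }
    assert (Dk2 : forall t, Derive (Derive k) t = - (k t * (k t ^ 2 / 2 + -1))).
    { intros t; rewrite (Derive_ext _ _ _ Dk).
      apply is_derive_unique; auto_derive; auto.
      rewrite_Derive (DS t); rewrite_Derive (DH t).
      transitivity (2 * S t * (H t ^ 2 - S t ^ 2)); [ring | ].
      replace (H t ^ 2) with (1 - S t ^ 2) by (rewrite <- (HSH t); ring).
      unfold k; field. }
    assert (CT : curvature_torsion x k (fun _ => 0)).
    { apply frenet_frame_elastica with (-1) 1.
      - now apply analytic_scal.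
      - lra.
      - intros t; rewrite Dk; unfold k.
        transitivity ((2 * S t ^ 2 - 1) ^ 2 + 4 * S t ^ 2 * H t ^ 2); [field | ].
        replace (H t ^ 2) with (1 - S t ^ 2) by (rewrite <- (HSH t); ring).
        ring.
      - exact Dk2.
      - intros t; eapply is_derive_eq; [apply Dx | ].
        rewrite Dk; unfold k, T; apply vec_ext; vec_simpl; field. }
    exists k; split; [split; [ | split] | split].
    + now apply torsion_zero_planar with k (fun _ => 0).
    + now exists (fun _ => 0).
    + exists (-1); intros t.
      change (Derive (Derive k) t + 1 / 2 * k t ^ 3 + -1 * k t = 0).
      rewrite Dk2; field.
    + intros Hx; assert (E := curvature_of_straight_line _ _ _ CT Hx 0).
      unfold k in E; rewrite S0 in E; lra.
    + exists 1, 0; split; [now left | intros t].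
      rewrite Rminus_0_r; unfold k; rewrite ES; field; apply Rgt_not_eq, cosh_pos.
Qed.

(** * The classification *)

Lemma analytic_derivatives (k : R -> R) : analytic k ->
  (forall t, is_derive k t (Derive k t)) /\
  (forall t, is_derive (Derive k) t (Derive_n k 2 t)) /\
  (forall t, continuous (Derive_n k 2) t).
Proof.
  intros Hk; split; [ | split]; intros t.
  - now apply Derive_correct, analytic_ex_derive.
  - now apply Derive_correct, analytic_ex_derive, analytic_Derive.
  - apply (ex_derive_continuous (V := R_NormedModule) (Derive (Derive k))).
    now apply analytic_ex_derive, analytic_Derive, analytic_Derive.
Qed.

(** The soliton is planar, so [b = 0] or [a = 0]; the circle is excluded by [k ^ 2 = 4] at the apex.
    For [b = 0] the first integral bounds [|s|] by [a], so [k ^ 2 >= (a - 1) ^ 2], and [k] tends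
    to zero. *)
Lemma soliton_parameters (x T v : R -> vec) (p : vec) (a b : R) :
  motion x T v p a b -> euler_soliton x -> a = 1 /\ b = 0.
Proof.
  intros M (k & (Hpl & (tau & H) & _) & Hx & e & t0 & He & Hk).
  assert (P := motion_profile M).
  assert (Hr := motion_r_pos M Hx).
  assert (HK := curvature_formula M H).
  assert (Hsq : forall t, k t ^ 2 = 4 / cosh (t - t0) ^ 2).
  { intros t; rewrite Hk; assert (h := cosh_pos (t - t0)).
    destruct He as [-> | ->]; field; lra. }
  assert (Hab : b = 0 \/ a = 0).
  { apply (torsion_zero_iff a b _ _ k tau P Hr HK (torsion_formula M H)).
    now apply (planar_torsion_zero x T v p a b k tau). }
  assert (Hb : b = 0).
  { destruct Hab as [ | ->]; trivial; exfalso.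
    destruct (circle_profile b _ _ P Hr t0) as [Hs _]; cbn beta in Hs.
    specialize (HK t0); rewrite Hsq, Hs, Rminus_diag, cosh_0 in HK; lra. }
  split; trivial; subst b.
  assert (Hge : forall t, (a - 1) ^ 2 <= k t ^ 2).
  { intros t; rewrite HK.
    assert (HE := profile_energy P t); cbn beta in HE.
    specialize (Hr t); assert (Ha := motion_a0 M).
    assert (h : 0 <= dot (v t) p ^ 2 * (a ^ 2 + 0 ^ 2 + 1 - 2 * dot (T t) p))
      by (apply Rmult_le_pos; [apply pow2_ge_0 | lra]).
    assert (dot (T t) p <= a) by nra.
    nra. }
  destruct (Req_dec a 1) as [ | Ha]; trivial; exfalso.
  set (d := Rabs (a - 1)).
  assert (Hd : 0 < d) by (apply Rabs_pos_lt; lra).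
  assert (Ed : (a - 1) ^ 2 = d ^ 2) by (unfold d; now rewrite pow2_abs).
  set (u := 4 / d).
  assert (Hu : d * u = 4) by (unfold u; field; lra).
  specialize (Hge (t0 + u)); rewrite Hsq, Ed in Hge.
  replace (t0 + u - t0) with u in Hge by ring.
  assert (Hc : (1 + u) / 2 < cosh u).
  { unfold cosh; assert (h := exp_pos (- u)).
    assert (h' := exp_ineq1_le u); lra. }
  assert (Hu0 : 0 < u) by (apply Rdiv_lt_0_compat; lra).
  assert (h := cosh_pos u).
  assert (Hp : 0 < cosh u ^ 2) by now apply pow_lt.
  assert (Hle : d ^ 2 * cosh u ^ 2 <= 4).
  { apply Rmult_le_compat_r with (r := cosh u ^ 2) in Hge; [ | lra].
    replace (4 / cosh u ^ 2 * cosh u ^ 2) with 4 in Hge by (field; lra); exact Hge. }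
  assert (Hdc : 2 < d * cosh u) by nra.
  nra.
Qed.

Lemma planar_non_inflectional (x T v : R -> vec) (p : vec) (a b : R) (k tau : R -> R) :
  motion x T v p a b -> ~ straight_line x -> curvature_torsion x k tau ->
  planar x -> non_inflectional_elastica x k.
Proof.
  intros M Hx H Hpl.
  assert (P := motion_profile M).
  assert (Hr := motion_r_pos M Hx).
  assert (HK := curvature_formula M H).
  assert (Hab : b = 0 \/ a = 0).
  { apply (torsion_zero_iff a b _ _ k tau P Hr HK (torsion_formula M H)).
    now apply (planar_torsion_zero x T v p a b k tau). }
  assert (Ak : analytic k) by (destruct H as (? & ? & ? & (_ & _ & _ & Ak & _) & _); exact Ak).
  destruct (analytic_derivatives k Ak) as (D1 & D2 & _).
  assert (E := planar_curvature_equation a b _ _ k _ _ P Hr HK D1 D2 Hab).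
  split; [ | split; trivial; intros t; apply E].
  split; [trivial | split; [now exists tau | ]].
  exists (- ((a ^ 2 + 1) / 2)); intros t; apply E.
Qed.

(** A constant torsion [c] satisfies [k ^ 2 (2 c - b) = b (a ^ 2 - 1)]: if [2 c <> b] the curvature is
    constant, which leaves only the planar circle. *)
Lemma constant_torsion_iff (x T v : R -> vec) (p : vec) (a b : R) (k tau : R -> R) :
  motion x T v p a b -> ~ straight_line x -> curvature_torsion x k tau ->
  (~ planar x /\ exists c : R, forall t, tau t = c) <-> a = 1 /\ 0 < b.
Proof.
  intros M Hx H.
  assert (P := motion_profile M).
  assert (Hr := motion_r_pos M Hx).
  assert (HK := curvature_formula M H).
  assert (Htau := torsion_formula M H).
  assert (Hz := torsion_zero_iff a b _ _ k tau P Hr HK Htau).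
  assert (Ha := motion_a0 M); assert (Hb := motion_b0 M).
  split.
  - intros [Hpl (c & Hc)].
    assert (Hn : ~ (b = 0 \/ a = 0))
      by (intros h; apply Hpl, (torsion_zero_planar x k tau H), Hz, h).
    split; [ | destruct (Rtotal_order b 0) as [ | [ | ]]; trivial; [lra | tauto]].
    assert (E : forall t, k t ^ 2 * (2 * c - b) = b * (a ^ 2 - 1))
      by (intros t; specialize (Htau t); rewrite Hc in Htau; lra).
    destruct (Req_dec (2 * c - b) 0) as [E0 | E0].
    + specialize (E 0); rewrite E0, Rmult_0_r in E.
      symmetry in E; apply Rmult_integral in E as [E | E]; [tauto | ].
      assert (E' : (a - 1) * (a + 1) = 0) by lra.
      apply Rmult_integral in E'; lra.
    + exfalso; apply Hn; right.
      apply (constant_curvature_circle a b ((a ^ 2 + 1 - b * (a ^ 2 - 1) / (2 * c - b)) / 2) _ _ P Hr).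
      intros t; specialize (HK t); specialize (E t).
      assert (k t ^ 2 = b * (a ^ 2 - 1) / (2 * c - b)) by (rewrite <- E; now field).
      lra.
  - intros [-> Hb0]; split.
    + intros Hpl; destruct (proj1 Hz); [ | lra | lra].
      now apply (planar_torsion_zero x T v p 1 b k tau).
    + exists (b / 2); intros t; apply Rminus_diag_uniq; revert t.
      apply (curvature_zeros_sparse 1 b _ _ k _ P Ha Hr HK).
      * destruct H as (? & ? & ? & (_ & _ & _ & _ & At) & _); intros t.
        apply (ex_derive_continuous (V := R_NormedModule)).
        auto_derive; now apply analytic_ex_derive.
      * intros t Hk0; specialize (Htau t).
        apply Rmult_eq_reg_l with (k t ^ 2); [lra | now apply pow_nonzero].
Qed.

(** The curvature equation has the elastica constant [A = (b ^ 2 - 4) / 4], and its first integral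
    makes [(k ^ 2 / 2 + A) ^ 2 + k' ^ 2] the square of [J = (b ^ 2 + 4) / 4]. *)
Lemma constant_torsion_inflectional (x T v : R -> vec) (p : vec) (b : R) (k tau : R -> R) :
  motion x T v p 1 b -> ~ straight_line x -> curvature_torsion x k tau -> 0 < b ->
  exists z : R -> vec, inflectional_elastica z k.
Proof.
  intros M Hx H Hb.
  assert (P := motion_profile M).
  assert (Hr := motion_r_pos M Hx).
  assert (HK := curvature_formula M H).
  assert (Ak : analytic k) by (destruct H as (? & ? & ? & (_ & _ & _ & Ak & _) & _); exact Ak).
  destruct (analytic_derivatives k Ak) as (D1 & D2 & C2).
  assert (E := constant_torsion_curvature_equation b _ _ k _ _ P Hr HK D1 D2 C2).
  destruct (elastica_with_curvature k ((b ^ 2 - 4) / 4) ((b ^ 2 + 4) / 4)) as (z & Hz); trivial.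
  - nra.
  - intros t; destruct (E t) as [-> _]; field.
  - intros t; change (Derive_n k 2 t = - (k t * (k t ^ 2 / 2 + (b ^ 2 - 4) / 4))).
    destruct (E t) as [_ ->]; field.
  - exists z; split; [split; [ | split] | split].
    + now apply (torsion_zero_planar z k (fun _ => 0)).
    + now exists (fun _ => 0).
    + exists ((b ^ 2 - 4) / 4); intros t; destruct (E t) as [_ ->]; field.
    + intros Hs; assert (Hk0 := curvature_of_straight_line z k _ Hz Hs).
      assert (h : forall t : R, (fun _ : R => 1) t = 0); [ | specialize (h 0); lra].
      apply (curvature_zeros_sparse 1 b _ _ k (fun _ => 1) P Rle_0_1 Hr HK).
      * intros t; apply continuous_const.
      * intros t h; now destruct h.
    + apply (curvature_vanishes b k (Derive k) (Derive_n k 2)); trivial; intros t; apply E.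
Qed.

Theorem proposition3p5 :
  (* (a) *)
  (forall (x y : R -> vec) (p : vec) (a b : R) (k tau : R -> R),
      geodesic_with x y p a b -> ~ straight_line x -> curvature_torsion x k tau ->
      (planar x <-> forall t, tau t = 0) /\
      (planar x -> non_inflectional_elastica x k) /\
      (* a = 0 is the unit circle with a superfluous normal vector p *)
      (a <> 0 ->
         (planar x <-> b = 0) /\
         forall (n : vec) (c : R), in_plane n c x -> dot n p = 0) /\
      (a = 0 -> circle_normal_to x y p)) /\
  (forall a b : R,
      (exists (x y : R -> vec) (p : vec),
          geodesic_with x y p a b /\ euler_soliton x) <-> a = 1 /\ b = 0) /\
  (forall a b : R,
      (exists (x y : R -> vec) (p : vec),
          geodesic_with x y p a b /\ straight_line x) <-> a = 1 /\ b = 0) /\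
  (* (b) *)
  (forall (x y : R -> vec) (p : vec) (a b : R) (k tau : R -> R),
      geodesic_with x y p a b -> ~ straight_line x -> curvature_torsion x k tau ->
      ((~ planar x /\ exists c : R, forall t, tau t = c) <-> a = 1 /\ 0 < b) /\
      (~ planar x -> (exists c : R, forall t, tau t = c) ->
         exists z : R -> vec, inflectional_elastica z k)).
Proof.
  split; [ | split; [ | split]].
  - intros x y p a b k tau G Hx H.
    destruct (geodesic_motion _ _ _ _ _ G) as (T & M).
    set (v := fun t => minus (x t) (y t)) in M.
    assert (Hpt : planar x <-> forall t, tau t = 0).
    { split; [now apply (planar_torsion_zero x T v p a b k tau) | ].
      now apply torsion_zero_planar with k. }
    assert (Hz := torsion_zero_iff a b _ _ k tau (motion_profile M)
      (motion_r_pos M Hx) (curvature_formula M H)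
      (torsion_formula M H)).
    split; [exact Hpt | split; [ | split]].
    + now apply (planar_non_inflectional x T v p a b k tau M).
    + intros Ha.
      assert (Hpb : planar x <-> b = 0) by tauto.
      split; trivial; intros n c Hn.
      assert (Hb : b = 0) by (apply Hpb; now exists n, c).
      subst b; now apply (plane_parallel_to_p x T v p a n c M Hx).
    + intros ->; now apply (circle_of_a_eq_0 x y T p b).
  - intros a b; split.
    + intros (x & y & p & G & Hs).
      destruct (geodesic_motion _ _ _ _ _ G) as (T & M).
      now apply (soliton_parameters _ _ _ _ _ _ M).
    + intros [-> ->]; exact soliton_geodesic.
  - intros a b; split.
    + intros (x & y & p & G & Hs).
      destruct (geodesic_motion _ _ _ _ _ G) as (T & M).
      now apply (straight_line_parameters _ _ _ _ _ _ M).
    + intros [-> ->]; exact line_geodesic.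
  - intros x y p a b k tau G Hx H.
    destruct (geodesic_motion _ _ _ _ _ G) as (T & M).
    set (v := fun t => minus (x t) (y t)) in M.
    assert (Hiff := constant_torsion_iff _ _ _ _ _ _ _ _ M Hx H).
    split; trivial; intros Hn Hc.
    destruct (proj1 Hiff (conj Hn Hc)) as [-> Hb].
    now apply (constant_torsion_inflectional x T v p b k tau M).
Qed.
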